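(* Let $\psi$ be a primitive Dirichlet character mod $q$ with $q>1$ and $\psi(-1)=1$ (i.e. $\psi(q-1)=1$). For each $n\geq1$ put $$S_n=\sum_{\substack{m=1\\ \gcd(m,n)=1}}^{\lfloor\frac{nq-1}{2}\rfloor}\psi(m)\,\chi_{(\frac{2m}{nq},1)}.$$ (1) If $v$ is a product of some distinct primes and $\gcd(v,q)=1$, then $S_v\in\mathcal{C}$. (2) Let $u$ be a positive even integer and let $\{c_d:d\mid u\}$ be complex numbers with $|c_1|>(\mathbf d(uu')-1)\cdot\max\{|c_d|:d\mid u,\ d>1\}$, where $u'$ is the largest divisor of $u$ relatively prime to $q$ and $\mathbf d(n)$ is the number of positive divisors of $n$. Then $\sum_{d\mid u}c_dS_d\in\mathcal{C}$.
   Context: $\chi_A$ is the characteristic function of $A\subseteq(0,1)$. $L^2=L^2(0,1)$; functions are identified with their odd $2$-periodic extensions to $\mathbb{R}$; $\mathcal{C}$ is the set of $\varphi\in L^2$ such that the span of $\{\varphi(kx):k\in\mathbb{N}\}$ is dense in $L^2$. A Dirichlet character mod $q$ is a completely multiplicative $q$-periodic function $\chi$ on $\mathbb{N}$ with $\chi(n)\ne0$ iff $\gcd(n,q)=1$ (extended $q$-periodically to $\mathbb{Z}$); it is primitive if it is not of the form $\psi\chi_q$ with $\psi$ a character of modulus a proper divisor of $q$ and $\chi_q$ the principal character mod $q$. *)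

(* Defs.v *)
From HB Require Import structures.
From mathcomp Require Import all_boot all_order all_algebra.
From mathcomp Require Import all_classical all_reals all_analysis.
From mathcomp Require Import complex.
Set Implicit Arguments. Unset Strict Implicit. Unset Printing Implicit Defensive.
Import Order.TTheory GRing.Theory Num.Theory.
Local Open Scope classical_set_scope.
Local Open Scope ring_scope.

(* Dirichlet character mod q (on nat; the extension to Z is q-periodic, so
   psi(-1) = psi(q-1)). *)
Definition dirichlet_char (R : realType) (q : nat) (chi : nat -> R[i]) : Prop :=
  [/\ (forall m n, chi (m * n)%N = chi m * chi n),
      (forall n, chi (n + q)%N = chi n) &
      (forall n, chi n != 0 <-> coprime n q)].

Definition primitive_char (R : realType) (q : nat) (chi : nat -> R[i]) : Prop :=
  dirichlet_char q chi /\
  ~ (exists d : nat, [/\ (d %| q)%N, d != q &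
       exists psi : nat -> R[i], dirichlet_char d psi /\
         forall n, chi n = psi n * (if coprime n q then 1 else 0)]).

Definition S_fun (R : realType) (psi : nat -> R[i]) (q n : nat) (x : R) : R[i] :=
  \sum_(1 <= m < ((n * q).-1 %/ 2).+1 | coprime m n)
     psi m * (if ((2 * m)%:R / (n * q)%:R < x) && (x < 1) then 1 else 0).

Definition odd_ext (R : realType) (phi : R -> R[i]) (x : R) : R[i] :=
  let y := x - 2 * (Num.floor (x / 2))%:~R in
  if (0 < y) && (y < 1) then phi y
  else if (1 < y) && (y < 2) then - phi (2 - y) else 0.

Definition L2 (R : realType) (f : R -> R[i]) : Prop :=
  [/\ measurable_fun (`]0%R, 1%R[ : set R) (fun x => complex.Re (f x)),
      measurable_fun (`]0%R, 1%R[ : set R) (fun x => complex.Im (f x)) &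
      (\int[lebesgue_measure]_(x in (`]0%R, 1%R[ : set R)) ((ComplexField.Normc.normc (f x)) ^+ 2)%:E < +oo)%E].

Definition cyclic_class (R : realType) (phi : R -> R[i]) : Prop :=
  L2 phi /\
  forall f : R -> R[i], L2 f -> forall eps : R, 0 < eps ->
    exists (N : nat) (a : nat -> R[i]),
      (\int[lebesgue_measure]_(x in (`]0%R, 1%R[ : set R))
          ((ComplexField.Normc.normc (f x - \sum_(1 <= k < N.+1) a k * odd_ext phi (k%:R * x))) ^+ 2)%:E
        < eps%:E)%E.

Definition ndiv (n : nat) : nat := size (divisors n).

Definition coprime_part (u q : nat) : nat := \max_(d <- divisors u | coprime d q) d.

(* Main.v *)
(** Let tau be the Gauss sum of psi, D_k f (x) = f (k x), and identify an odd
   2-periodic function with its sequence of sine coefficients, so that D_k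
   becomes an isometry of l2. Expanding indicator functions in sine series and
   evaluating Gauss sums of imprimitive characters gives
     S_1 = (tau / pi) sum_j psi(j)^-1 / j sin (pi j x)      (psi(j)^-1 = 0 if psi(j) = 0)
     S_(p n) = D_p S_n - [p does not divide n] psi(p) S_n   (p prime).
   Sieving S_1 by the operators 1 - psi(p)^-1 / p D_p for p <= P leaves a
   multiple of sin (pi x) plus an l2 tail O(1/P), so S_1 is cyclic. In (1), each
   factor D_p - psi(p) has |psi(p)| = 1 and preserves cyclicity by a mean ergodic
   argument. In (2), S_d = A_d S_1 where A_d is a combination of dilations with
   coefficients of total modulus at most the number a(d) of squarefree divisors
   of d prime to q; as sum_(d | u) a(d) = d(u u'), the operator
   c_1^-1 sum_(d | u) c_d A_d is a perturbation of the identity by less than 1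
   and a Neumann series recovers S_1. *)
Require Import Defs.
From HB Require Import structures.
From mathcomp Require Import all_boot all_order all_algebra.
From mathcomp Require Import all_classical all_reals all_analysis.
From mathcomp Require Import complex measurable_realfun ring lra zify.
Set Implicit Arguments. Unset Strict Implicit. Unset Printing Implicit Defensive.
Import Order.TTheory GRing.Theory Num.Theory.
Import numFieldNormedType.Exports.
Local Open Scope ring_scope.

Local Notation normc := ComplexField.Normc.normc.

(** * Dilations of sequences *)

Section ComplexModulus.
Variable R : realType.
Implicit Types z w : R[i].

(** The dilates of [kronecker], the coefficient sequence of sin (pi x), are all the basis vectors,
    so cyclicity of an expanded function reduces to [l2span b kronecker] for its coefficients b.
    Membership in a closed span is phrased with truncated sums bounded uniformly in N. Two analytic
    facts lead back to functions: a Bessel bound from coefficients to L2 norms, and density of sine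
    polynomials. Both density and the expansion of S_n rest on a single family, the indicators of
    (a, 1): their sine series are combinations of sawtooth series, whose partial sums are uniformly
    bounded and converge almost everywhere, hence in L2. Two obstacles shape the rest. S_n sums over
    half a period only: evenness of psi folds the full Gauss sum onto this half, and the same
    identity at frequency 0 removes the contribution of the common endpoint 1. Moreover D_p - psi(p)
    has no bounded inverse, because D_p is a unilateral shift and |psi(p)| = 1; a Neumann series
    therefore cannot serve in (1), and averages of iterates replace it. *)

Lemma normcE2 z : normc z ^+ 2 = complex.Re z ^+ 2 + complex.Im z ^+ 2.
Proof. by case: z => a b /=; rewrite sqr_sqrtr // addr_ge0 ?sqr_ge0. Qed.

Lemma normc_ge0 z : 0 <= normc z.
Proof. by case: z => a b /=; apply: sqrtr_ge0. Qed.

Lemma normc_real (x : R) : normc (x%:C)%C = `|x|.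
Proof. by rewrite /= expr0n addr0 sqrtr_sqr. Qed.

Lemma normcM z w : normc (z * w) = normc z * normc w.
Proof. exact: ComplexField.Normc.normcM. Qed.

Lemma normcX z n : normc (z ^+ n) = normc z ^+ n.
Proof.
elim: n => [|n IH]; first by rewrite !expr0 ComplexField.Normc.normc1.
by rewrite !exprS normcM IH.
Qed.

Lemma ler_normc_sum (I : Type) (s : seq I) (P : pred I) (F : I -> R[i]) :
  normc (\sum_(i <- s | P i) F i) <= \sum_(i <- s | P i) normc (F i).
Proof.
elim/big_rec2: _ => [|i x y _ IH]; first by rewrite ComplexField.Normc.normc0.
by apply: le_trans (le_normcD _ _) _; rewrite lerD2l.
Qed.

Lemma sqr_normcD z w : normc (z + w) ^+ 2 <= 2 * normc z ^+ 2 + 2 * normc w ^+ 2.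
Proof.
rewrite !normcE2; case: z w => [a b] [c d] /=.
rewrite -subr_ge0 (_ : _ - _ = (a - c) ^+ 2 + (b - d) ^+ 2); last by ring.
by rewrite addr_ge0 ?sqr_ge0.
Qed.

(** Cauchy-Schwarz by induction on the list. With A, B, D the three partial sums, B^2 <= A D gives 4
    y^2 B^2 <= 4 y^2 A D <= (D + A y^2)^2, which controls the new cross term. *)
Lemma sqr_sum_weighted (I : Type) (s : seq I) (w x : I -> R) :
  (forall i, 0 <= w i) -> (forall i, 0 <= x i) ->
  (\sum_(i <- s) w i * x i) ^+ 2 <=
  (\sum_(i <- s) w i) * \sum_(i <- s) w i * x i ^+ 2.
Proof.
move=> w0 x0; elim: s => [|i s IH]; first by rewrite !big_nil mul0r expr0n.
rewrite !big_cons; move: IH.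
have : 0 <= \sum_(j <- s) w j * x j by apply: sumr_ge0 => j _; apply: mulr_ge0.
have : 0 <= \sum_(j <- s) w j by apply: sumr_ge0.
have : 0 <= \sum_(j <- s) w j * x j ^+ 2.
  by apply: sumr_ge0 => j _; rewrite mulr_ge0 ?sqr_ge0.
move: (\sum_(j <- s) w j) (\sum_(j <- s) w j * x j)
  (\sum_(j <- s) w j * x j ^+ 2) (w0 i) (x0 i) => A B D.
move: (w i) (x i) => u y u0 y0 D0 A0 B0 BAD.
have key : 2 * (y * B) <= D + A * y ^+ 2.
  have l0 : 0 <= 2 * (y * B) by rewrite !mulr_ge0.
  have r0 : 0 <= D + A * y ^+ 2 by rewrite addr_ge0 // mulr_ge0 // sqr_ge0.
  rewrite -ler_sqr //.
  have h1 : (2 * (y * B)) ^+ 2 <= 4 * y ^+ 2 * (A * D).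
    rewrite (_ : (2 * (y * B)) ^+ 2 = 4 * y ^+ 2 * B ^+ 2); last by ring.
    by rewrite ler_wpM2l // mulr_ge0 ?sqr_ge0.
  apply: le_trans h1 _; rewrite -subr_ge0.
  by rewrite (_ : _ - _ = (D - A * y ^+ 2) ^+ 2); [rewrite sqr_ge0 | ring].
have := ler_wpM2l u0 key; nra.
Qed.

End ComplexModulus.

Section Dilations.
Variable R : realType.
Local Notation C := R[i].
Implicit Types (f g b : nat -> C) (s t : seq (nat * C)) (k n N : nat).

(** The effect of f(x) -> f(kx) on sine coefficients: frequency m moves to km. *)
Definition dilate k f n : C := if (k %| n)%N then f (n %/ k)%N else 0.

(** Indices may repeat in s, so that concatenation is addition; [weight] counts the repetitions and
    bounds the operator norm. *)
Definition dilcomb s f n : C := \sum_(e <- s) e.2 * dilate e.1 f n.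

Definition posidx s := all (fun e : nat * C => 0 < e.1)%N s.

Definition weight s : R := \sum_(e <- s) normc e.2.

(** Index 0 carries no frequency and is left out; hence the many statements restricted to positive
    n. *)
Definition sqnorm N f : R := \sum_(1 <= n < N.+1) normc (f n) ^+ 2.

Lemma dil_comp k l f n : (0 < k)%N -> (0 < l)%N ->
  dilate k (dilate l f) n = dilate (k * l) f n.
Proof.
move=> k0 l0; rewrite /dilate.
case: (boolP (k %| n)%N) => [/dvdnP[m ->]|kn].
  by rewrite mulnK // (mulnC m) dvdn_pmul2l // divnMl.
by case: ifP => // kln; case/negP: kn; apply: dvdn_trans kln; apply: dvdn_mulr.
Qed.

Lemma dil1 f n : dilate 1 f n = f n.
Proof. by rewrite /dilate dvd1n divn1. Qed.

Lemma nrm_ge0 N f : 0 <= sqnorm N f.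
Proof. by apply: sumr_ge0 => n _; rewrite sqr_ge0. Qed.

Lemma eq_nrm N f g : (forall n, (0 < n)%N -> f n = g n) -> sqnorm N f = sqnorm N g.
Proof.
move=> fg; rewrite /sqnorm !big_nat; apply: eq_bigr => n /andP[n0 _].
by rewrite fg.
Qed.

Lemma nrmD N f g : sqnorm N (fun n => f n + g n) <= 2 * sqnorm N f + 2 * sqnorm N g.
Proof.
rewrite /sqnorm !mulr_sumr -big_split /=.
by apply: ler_sum => n _; apply: sqr_normcD.
Qed.

Lemma nrmZ N c f : sqnorm N (fun n => c * f n) = normc c ^+ 2 * sqnorm N f.
Proof.
by rewrite /sqnorm mulr_sumr; apply: eq_bigr => n _; rewrite normcM exprMn.
Qed.

Lemma sum_pick_le m n k (a : R) : 0 <= a ->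
  \sum_(m <= i < n) (if i == k then a else 0) <= a.
Proof.
move=> a0; rewrite -big_mkcond /=.
case: (boolP (k \in index_iota m n)) => kin.
  by rewrite (big_rem k) //= eqxx big1_seq ?addr0 // => i /andP[/eqP -> /=];
     rewrite mem_rem_uniqF ?iota_uniq.
by rewrite big1_seq // => i /andP[/eqP -> /(negP kin)].
Qed.

(** Truncation turns the isometry into an inequality. Each nonzero term at n = km is charged to m <=
    N, and every m is charged at most once. *)
Lemma nrm_dil N k f : (0 < k)%N -> sqnorm N (dilate k f) <= sqnorm N f.
Proof.
move=> k0; rewrite /sqnorm.
apply: (@le_trans _ _ (\sum_(1 <= n < N.+1) \sum_(1 <= m < N.+1)
   (if n == (k * m)%N then normc (f m) ^+ 2 else 0))).
  rewrite [X in X <= _]big_nat [X in _ <= X]big_nat.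
  apply: ler_sum => n /andP[n0 nN].
  have ge0 : 0 <= \sum_(1 <= m < N.+1) (if n == (k * m)%N then normc (f m) ^+ 2 else 0).
    by apply: sumr_ge0 => m _; case: ifP => // _; rewrite sqr_ge0.
  rewrite /dilate; case: ifP => [/dvdnP[m nm]|_]; last first.
    by rewrite ComplexField.Normc.normc0 expr0n.
  have min : m \in index_iota 1 N.+1.
    by rewrite mem_index_iota; move: n0 nN; rewrite nm; nia.
  rewrite nm mulnK // (big_rem m) //= mulnC eqxx lerDl.
  by apply: sumr_ge0 => i _; case: ifP => // _; rewrite sqr_ge0.
rewrite exchange_big /=; apply: ler_sum => m _.
by apply: sum_pick_le; rewrite sqr_ge0.
Qed.

Lemma wt_ge0 s : 0 <= weight s.
Proof. by apply: sumr_ge0 => e _; apply: normc_ge0. Qed.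

(** The triangle inequality in squared form: weighted Cauchy-Schwarz at each n, then [nrm_dil] for
    each dilation. *)
Lemma nrm_dcomb N s f : posidx s -> sqnorm N (dilcomb s f) <= weight s ^+ 2 * sqnorm N f.
Proof.
move=> s0; rewrite {1}/sqnorm.
apply: (@le_trans _ _ (\sum_(1 <= n < N.+1)
   weight s * \sum_(e <- s) normc e.2 * normc (dilate e.1 f n) ^+ 2)).
  apply: ler_sum => n _.
  apply: (@le_trans _ _ ((\sum_(e <- s) normc e.2 * normc (dilate e.1 f n)) ^+ 2)).
    rewrite ler_sqr ?nnegrE ?normc_ge0 //; last first.
      by apply: sumr_ge0 => e _; rewrite mulr_ge0 ?normc_ge0.
    apply: le_trans (ler_normc_sum _ _ _) _.
    by apply: ler_sum => e _; rewrite normcM.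
  by apply: sqr_sum_weighted => e; apply: normc_ge0.
rewrite -mulr_sumr expr2 -mulrA ler_wpM2l ?wt_ge0 //.
rewrite exchange_big /= /weight mulr_suml.
rewrite big_seq [X in _ <= X]big_seq; apply: ler_sum => e es.
rewrite -mulr_sumr ler_wpM2l ?normc_ge0 //.
by apply: nrm_dil; apply: (allP s0).
Qed.

Lemma dcomb_cat s t f n : dilcomb (s ++ t) f n = dilcomb s f n + dilcomb t f n.
Proof. by rewrite /dilcomb big_cat. Qed.

Definition scal_comb (c : C) s := [seq (e.1, c * e.2) | e <- s].

Lemma dcomb_scal c s f n : dilcomb (scal_comb c s) f n = c * dilcomb s f n.
Proof.
by rewrite /dilcomb big_map mulr_sumr; apply: eq_bigr => e _ /=; rewrite mulrA.
Qed.

Lemma wt_scal c s : weight (scal_comb c s) = normc c * weight s.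
Proof.
by rewrite /weight big_map mulr_sumr; apply: eq_bigr => e _ /=; rewrite normcM.
Qed.

Lemma pos_scal c s : posidx (scal_comb c s) = posidx s.
Proof. by rewrite /posidx all_map; apply: eq_all => e. Qed.

Lemma wt_cat s t : weight (s ++ t) = weight s + weight t.
Proof. by rewrite /weight big_cat. Qed.

Lemma pos_cat s t : posidx (s ++ t) = posidx s && posidx t.
Proof. exact: all_cat. Qed.

Definition dil_comb k s := [seq ((k * e.1)%N, e.2) | e <- s].

Lemma pos_dil k s : (0 < k)%N -> posidx s -> posidx (dil_comb k s).
Proof.
by move=> k0 s0; rewrite /posidx all_map; apply: sub_all s0 => e /=; rewrite muln_gt0 k0.
Qed.

Lemma wt_dil k s : weight (dil_comb k s) = weight s.
Proof. by rewrite /weight big_map. Qed.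

Lemma dcomb_dil k s f n : (0 < k)%N -> posidx s ->
  dilcomb (dil_comb k s) f n = dilate k (dilcomb s f) n.
Proof.
move=> k0 s0; rewrite /dilcomb big_map /=.
transitivity (\sum_(e <- s) e.2 * dilate k (dilate e.1 f) n).
  rewrite big_seq [RHS]big_seq; apply: eq_bigr => e es.
  by rewrite dil_comp //; apply: (allP s0).
rewrite /dilate; case: ifP => // _.
by rewrite big1 // => e _; rewrite mulr0.
Qed.

Lemma dil_lin k c f g n :
  dilate k (fun m => c * f m + g m) n = c * dilate k f n + dilate k g n.
Proof. by rewrite /dilate; case: ifP => // _; rewrite mulr0 addr0. Qed.

Lemma dil_sum (I : Type) (r : seq I) k (F : I -> nat -> C) n :
  dilate k (fun m => \sum_(i <- r) F i m) n = \sum_(i <- r) dilate k (F i) n.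
Proof. by rewrite /dilate; case: ifP => // _; rewrite big1. Qed.

Lemma dilZ k c f n : dilate k (fun m => c * f m) n = c * dilate k f n.
Proof. by rewrite /dilate; case: ifP => // _; rewrite mulr0. Qed.

Lemma eq_dil k f g n : (0 < k)%N -> (0 < n)%N ->
  (forall m, (0 < m)%N -> f m = g m) -> dilate k f n = dilate k g n.
Proof.
move=> k0 n0 fg; rewrite /dilate; case: ifP => // kn; apply: fg.
by rewrite divn_gt0 // dvdn_leq.
Qed.

Lemma eq_dcomb s f g n : posidx s -> (0 < n)%N ->
  (forall m, (0 < m)%N -> f m = g m) -> dilcomb s f n = dilcomb s g n.
Proof.
move=> s0 n0 fg; rewrite /dilcomb big_seq [RHS]big_seq; apply: eq_bigr => e es.
by rewrite (@eq_dil _ f g) //; apply: (allP s0).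
Qed.

Lemma dcomb_lin s c f g n :
  dilcomb s (fun m => c * f m + g m) n = c * dilcomb s f n + dilcomb s g n.
Proof.
rewrite /dilcomb mulr_sumr -big_split; apply: eq_bigr => e _ /=.
by rewrite dil_lin; ring.
Qed.

Lemma dcombC s t f n : posidx s -> posidx t ->
  dilcomb s (dilcomb t f) n = dilcomb t (dilcomb s f) n.
Proof.
move=> s0 t0; rewrite /dilcomb.
transitivity (\sum_(e <- s) \sum_(e' <- t) e.2 * e'.2 * dilate e.1 (dilate e'.1 f) n).
  apply: eq_bigr => e _; rewrite dil_sum mulr_sumr; apply: eq_bigr => e' _.
  by rewrite dilZ mulrA.
rewrite exchange_big /= big_seq [RHS]big_seq; apply: eq_bigr => e' e't.
rewrite dil_sum mulr_sumr big_seq [RHS]big_seq; apply: eq_bigr => e es.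
have e0 : (0 < e.1)%N by apply: (allP s0).
have e'0 : (0 < e'.1)%N by apply: (allP t0).
by rewrite dilZ !dil_comp // mulnC; ring.
Qed.

End Dilations.

(** * Closed dilation spans in l2 *)

Section Closure.
Variable R : realType.
Local Notation C := R[i].
Implicit Types (f g b : nat -> C) (s t : seq (nat * C)) (k n N : nat).

(** Closed linear span of the dilates of b. The same s must serve all N, so the bound is one on the
    full l2 distance. *)
Definition l2span b f := forall eps : R, 0 < eps ->
  exists2 s, posidx s & forall N, sqnorm N (fun n => f n - dilcomb s b n) <= eps.

Definition kronecker n : C := (n == 1)%:R.

Lemma eq_Cl b f g : (forall n, (0 < n)%N -> f n = g n) -> l2span b f -> l2span b g.
Proof.
move=> fg bf eps e0; have [s s0 h] := bf _ e0; exists s => // N.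
by rewrite (_ : sqnorm _ _ = sqnorm N (fun n => f n - dilcomb s b n)) //; apply: eq_nrm => n n0; rewrite fg.
Qed.

Lemma eq_Cll b b' f : (forall n, (0 < n)%N -> b n = b' n) -> l2span b f -> l2span b' f.
Proof.
move=> bb bf eps e0; have [s s0 h] := bf _ e0; exists s => // N.
rewrite (_ : sqnorm _ _ = sqnorm N (fun n => f n - dilcomb s b n)) //; apply: eq_nrm => n n0.
by rewrite (eq_dcomb s0 n0 bb).
Qed.

Lemma nrm0 N f : (forall n, (0 < n)%N -> f n = 0) -> sqnorm N f = 0.
Proof.
move=> f0; rewrite (eq_nrm _ (g := fun=> 0)) // /sqnorm big1 // => n _.
by rewrite ComplexField.Normc.normc0 expr0n.
Qed.

Lemma l2span_dcomb b s : posidx s -> l2span b (dilcomb s b).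
Proof.
by move=> s0 eps e0; exists s => // N; rewrite nrm0 ?ltW // => n _; rewrite subrr.
Qed.

Lemma l2span_lim b f :
  (forall eps : R, 0 < eps -> exists2 g, l2span b g & forall N, sqnorm N (fun n => f n - g n) <= eps) ->
  l2span b f.
Proof.
move=> H eps e0; have e4 : 0 < eps / 4 by rewrite divr_gt0.
have [g bg h] := H _ e4; have [s s0 hs] := bg _ e4; exists s => // N.
rewrite (eq_nrm _ (g := fun n => (f n - g n) + (g n - dilcomb s b n))).
  by apply: le_trans (nrmD _ _ _) _; have := h N; have := hs N; lra.
by move=> n _; rewrite addrA subrK.
Qed.

(** Composition of the two operators, that is, Dirichlet convolution of their coefficients. *)
Fixpoint comp_comb s t := if s is e :: s' then scal_comb e.2 (dil_comb e.1 t) ++ comp_comb s' t else [::].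

Lemma pos_comp s t : posidx s -> posidx t -> posidx (comp_comb s t).
Proof.
move=> + t0; elim: s => //= e s IH /andP[e0 s0].
by rewrite pos_cat pos_scal pos_dil //= IH.
Qed.

Lemma dcomb_comp s t f n : posidx s -> posidx t ->
  dilcomb (comp_comb s t) f n = dilcomb s (dilcomb t f) n.
Proof.
move=> + t0; elim: s => [|e s IH] /=; first by rewrite /dilcomb !big_nil.
move=> /andP[e0 s0]; rewrite dcomb_cat IH // dcomb_scal dcomb_dil //.
by rewrite [RHS]big_cons.
Qed.

Lemma dcombB s f g n :
  dilcomb s (fun m => f m - g m) n = dilcomb s f n - dilcomb s g n.
Proof.
rewrite addrC -mulN1r -dcomb_lin; congr dilcomb.
by apply/funext => m; rewrite addrC mulN1r.
Qed.

Lemma eps_wt s (eps : R) : 0 < eps ->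
  0 < eps / (weight s ^+ 2 + 1) /\
  forall x, x <= eps / (weight s ^+ 2 + 1) -> weight s ^+ 2 * x <= eps.
Proof.
move=> e0; have w0 : 0 < weight s ^+ 2 + 1 by rewrite ltr_wpDl ?sqr_ge0.
split=> [|x]; first by rewrite divr_gt0.
rewrite ler_pdivlMr // => xle.
have [x0|x0] := leP 0 x; first by nra.
by apply: le_trans (ltW e0); rewrite nmulr_lle0 ?sqr_ge0.
Qed.

Lemma l2span_op b f s : posidx s -> l2span b f -> l2span b (dilcomb s f).
Proof.
move=> s0 bf eps e0; have [e'0 he] := eps_wt s e0.
have [t t0 ht] := bf _ e'0; exists (comp_comb s t); first exact: pos_comp.
move=> N; rewrite (eq_nrm _ (g := dilcomb s (fun n => f n - dilcomb t b n))).
  by apply: le_trans (nrm_dcomb _ _ s0) _; apply: he.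
by move=> n _; rewrite dcomb_comp // dcombB.
Qed.

(** Dilations commute, so the combination t that approximates f from b also approximates the image
    of f from the image of b. *)
Lemma l2span_image b f s : posidx s -> l2span b f -> l2span (dilcomb s b) (dilcomb s f).
Proof.
move=> s0 bf eps e0; have [e'0 he] := eps_wt s e0.
have [t t0 ht] := bf _ e'0; exists t => // N.
rewrite (eq_nrm _ (g := dilcomb s (fun n => f n - dilcomb t b n))).
  by apply: le_trans (nrm_dcomb _ _ s0) _; apply: he.
by move=> n _; rewrite dcombC // dcombB.
Qed.

Lemma l2span_trans b f g : l2span b f -> l2span f g -> l2span b g.
Proof.
move=> bf fg; apply: l2span_lim => eps e0; have [s s0 hs] := fg _ e0.
by exists (dilcomb s f) => //; apply: l2span_op.
Qed.

Lemma l2span_refl b : l2span b b.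
Proof.
have p1 : posidx [:: (1%N, 1 : C)] by [].
apply: eq_Cl (l2span_dcomb b p1) => n _.
by rewrite /dilcomb big_seq1 dil1 mul1r.
Qed.

Lemma l2span_lin b f g c : l2span b f -> l2span b g -> l2span b (fun n => c * f n + g n).
Proof.
move=> bf bg eps e0; pose m := normc c ^+ 2 + 1.
have m0 : 0 < m by rewrite ltr_wpDl ?sqr_ge0.
have em : 0 < eps / (4 * m) by rewrite divr_gt0 // mulr_gt0.
have e4 : 0 < eps / 4 by rewrite divr_gt0.
have [s s0 hs] := bf _ em; have [t t0 ht] := bg _ e4.
exists (scal_comb c s ++ t); first by rewrite pos_cat pos_scal s0.
move=> N; rewrite (eq_nrm _ (g := fun n => c * (f n - dilcomb s b n) + (g n - dilcomb t b n))).
  apply: le_trans (nrmD _ _ _) _; rewrite nrmZ; move: (hs N) (ht N).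
  have := nrm_ge0 N (fun n => f n - dilcomb s b n).
  move: (sqnorm N (fun n => f n - _)) => x x0 h2; move: (sqnorm N _) => y h1.
  move: h2; rewrite ler_pdivlMr ?mulr_gt0 // /m.
  have := sqr_ge0 (normc c); move: (normc c ^+ 2) => z z0 h2.
  have : 4 * (x * z) + 4 * x <= eps by apply: le_trans h2; rewrite le_eqVlt; apply/orP; left; apply/eqP; ring.
  by rewrite (mulrC z); lra.
by move=> n _; rewrite dcomb_cat dcomb_scal; ring.
Qed.

Lemma l2span_0 b : l2span b (fun=> 0).
Proof.
have p1 : posidx ([::] : seq (nat * C)) by [].
by apply: eq_Cl (l2span_dcomb b p1) => n _; rewrite /dilcomb big_nil.
Qed.

Lemma l2span_sum (I : Type) (r : seq I) b (F : I -> nat -> C) :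
  (forall i, l2span b (F i)) -> l2span b (fun n => \sum_(i <- r) F i n).
Proof.
move=> bF; elim: r => [|i r IH].
  by apply: eq_Cl (l2span_0 b) => n _; rewrite big_nil.
by apply: eq_Cl (l2span_lin 1 (bF i) IH) => n _; rewrite big_cons mul1r.
Qed.

Lemma l2span_Z b f c : l2span b f -> l2span b (fun n => c * f n).
Proof. by move=> bf; apply: eq_Cl (l2span_lin c bf (l2span_0 b)) => n _; rewrite addr0. Qed.

Lemma l2span_dil b f k : (0 < k)%N -> l2span b f -> l2span b (dilate k f).
Proof.
move=> k0 bf; have p1 : posidx [:: (k, 1 : C)] by rewrite /posidx /= k0.
by apply: eq_Cl (l2span_op p1 bf) => n _; rewrite /dilcomb big_seq1 mul1r.
Qed.

Lemma dil_kron k n : (0 < k)%N -> dilate k kronecker n = (n == k)%:R.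
Proof.
move=> k0; rewrite /dilate /kronecker; case: ifPn => [/dvdnP[m ->]|kn].
  by rewrite mulnK // -{2}[k]mul1n eqn_pmul2r.
by case: eqP kn => // ->; rewrite dvdnn.
Qed.

(* Mean ergodic argument: [D_p] is a unilateral shift on the powers of p, so the
   Cesaro means of the unimodular iterates of the Kronecker sequence tend to 0. *)
Lemma l2span_shift_minus p (c : C) : prime p -> normc c = 1 ->
  l2span (fun n => dilate p kronecker n - c * kronecker n) kronecker.
Proof.
move=> pp c1; have p1 := prime_gt1 pp; set b := (X in l2span X); pose t := c^-1.
have t1 : normc t = 1 by rewrite ComplexField.Normc.normcV c1 invr1.
have c0 : c != 0.
  by apply/eqP => c0; move/eqP: c1; rewrite c0 ComplexField.Normc.normc0 eq_sym oner_eq0.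
(* Telescoping: f (j+1) = f j - t^(j+1) D_(p^j) b, so every f j lies in the span of b; the Cesaro
   mean of the f j is the approximant. *)
pose f j n : C := kronecker n - t ^+ j * (n == (p ^ j)%N)%:R.
have bf j : l2span b (f j).
  elim: j => [|j IH].
    by apply: eq_Cl (l2span_0 b) => n _; rewrite /f expr0 expn0 mul1r subrr.
  have pj : (0 < p ^ j)%N by rewrite expn_gt0 ltnW.
  apply: eq_Cl (l2span_lin (- t ^+ j.+1) (l2span_dil pj (l2span_refl b)) IH) => n n0.
  rewrite (_ : dilate _ _ _ = - c * dilate (p ^ j) kronecker n + dilate (p ^ j) (dilate p kronecker) n).
    rewrite dil_comp ?(ltnW p1) // !dil_kron ?muln_gt0 ?pj ?(ltnW p1) //.
    rewrite /f -expnSr exprS mulrDr mulrA.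
    have -> : - (t * t ^+ j) * - c = t ^+ j.
      by rewrite mulrNN mulrAC /t mulVf // mul1r.
    ring.
  rewrite -dil_lin; congr dilate; apply/funext => m; rewrite /b.
  by rewrite mulNr addrC.
apply: l2span_lim => eps e0.
pose N0 := (Num.truncn eps^-1).+1.
have hN0 : eps^-1 < N0%:R by rewrite /N0; apply: truncnS_gt.
have N00 : 0 < N0%:R :> R by rewrite ltr0n.
exists (fun n => (N0%:R)^-1 * \sum_(j <- iota 1 N0) f j n).
  by apply: l2span_Z; apply: l2span_sum.
move=> N.
rewrite (eq_nrm _ (g := fun n => (N0%:R)^-1 * \sum_(j <- iota 1 N0) t ^+ j * (n == (p ^ j)%N)%:R)); last first.
  move=> n n0; rewrite /f sumrB big_const_seq count_predT size_iota.
  rewrite iter_addr_0 mulrBr -[kronecker n *+ N0]mulr_natl mulKf; last by rewrite pnatr_eq0.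
  ring.
rewrite nrmZ.
have -> : normc (N0%:R^-1 : C) = N0%:R^-1.
  rewrite ComplexField.Normc.normcV (_ : N0%:R = (N0%:R)%:C%C); last by rewrite rmorph_nat.
  by rewrite normc_real ger0_norm.
(* The powers p^j are distinct: at each n only j = [logn p n] can contribute, and the N0 unimodular
   terms have total squared norm at most N0. Dividing by N0^2 leaves 1/N0 < eps. *)
have hn : sqnorm N (fun n => \sum_(j <- iota 1 N0) t ^+ j * (n == (p ^ j)%N)%:R) <= N0%:R.
  rewrite /sqnorm.
  apply: (@le_trans _ _ (\sum_(1 <= n < N.+1) \sum_(1 <= j < N0.+1) (if n == (p ^ j)%N then 1 else 0))).
    apply: ler_sum => n _; set S := \sum_(1 <= j < _) _.
    have S0 : 0 <= S by apply: sumr_ge0 => j _; case: ifP.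
    have S1 : S <= 1.
      apply: (@le_trans _ _ (\sum_(1 <= j < N0.+1) (if j == logn p n then 1 else 0))).
        apply: ler_sum => j _; case: (n =P (p ^ j)%N) => [->|_]; last by case: ifP.
        by rewrite pfactorK // eqxx.
      exact: sum_pick_le.
    have : normc (\sum_(j <- iota 1 N0) t ^+ j * (n == (p ^ j)%N)%:R) <= S.
      apply: le_trans (ler_normc_sum _ _ _) _.
      rewrite /S /index_iota subSS subn0; apply: ler_sum => j _.
      rewrite normcM normcX t1 expr1n mul1r.
      by case: ifP => _; rewrite ?ComplexField.Normc.normc0 ?ComplexField.Normc.normc1.
    have := normc_ge0 (\sum_(j <- iota 1 N0) t ^+ j * (n == (p ^ j)%N)%:R).
    move: (normc _) S S0 S1 => x y; nra.
  rewrite exchange_big /=.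
  apply: (@le_trans _ _ (\sum_(1 <= j < N0.+1) 1)).
    by apply: ler_sum => j _; apply: sum_pick_le.
  by rewrite sumr_const_nat subn1.
rewrite expr2 -mulrA; apply: (@le_trans _ _ (N0%:R^-1 * (N0%:R^-1 * N0%:R))).
  by rewrite !ler_wpM2l // invr_ge0 ltW.
by rewrite mulVf ?gt_eqF // mulr1 -[eps]invrK lef_pV2 ?posrE ?invr_gt0 // ltW.
Qed.

End Closure.

(** * Neumann series and the sieve by Euler factors *)

Section Invertibility.
Variable R : realType.
Local Notation C := R[i].
Implicit Types (f g b : nat -> C) (s t : seq (nat * C)) (k n N : nat).

Lemma expr_small (x K eps : R) : 0 <= x < 1 -> 0 < eps -> exists J, x ^+ J * K <= eps.
Proof.
move=> /andP[x0 x1] e0.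
have cv : ((fun n => x ^+ n) @ \oo --> (0 : R))%classic by apply: cvg_expr; rewrite ger0_norm.
have d0 : 0 < eps / (`|K| + 1) by rewrite divr_gt0 // ltr_wpDl.
move/cvgrPdist_lt : cv => /(_ _ d0) [J _ /(_ J (leqnn J))] /=.
rewrite sub0r normrN ger0_norm ?exprn_ge0 // ltr_pdivlMr ?ltr_wpDl // => h.
exists J; apply: le_trans (ltW h); rewrite ler_wpM2l ?exprn_ge0 //.
by apply: le_trans (ler_norm K) _; rewrite lerDl.
Qed.

(** With T = [dilcomb s], the partial Neumann sum applied to b + T b equals b - (-T)^j b, and the
    remainder y j = (-T)^j b tends to 0 because b is square summable and T has norm below 1. *)
Lemma l2span_neumann b s K : posidx s -> weight s < 1 -> (forall N, sqnorm N b <= K) ->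
  l2span (fun n => b n + dilcomb s b n) b.
Proof.
move=> s0 ws bK; set b' := (X in l2span X).
pose s' := scal_comb (-1) s.
have s'0 : posidx s' by rewrite pos_scal.
have ws' : weight s' = weight s.
  by rewrite wt_scal normcN ComplexField.Normc.normc1 mul1r.
pose y j := iter j (dilcomb s') b.
have ny j N : sqnorm N (y j) <= (weight s ^+ 2) ^+ j * K.
  elim: j => [|j IH]; first by rewrite expr0 mul1r.
  apply: le_trans (nrm_dcomb _ _ s'0) _; rewrite ws' (exprS (weight s ^+ 2)) -mulrA.
  by rewrite ler_wpM2l ?sqr_ge0.
(* Recursion: b - y (j+1) = (b + T b) - T (b - y j). *)
have bf j : l2span b' (fun n => b n - y j n).
  elim: j => [|j IH]; first by apply: eq_Cl (l2span_0 b') => n _; rewrite subrr.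
  apply: eq_Cl (l2span_lin 1 (l2span_refl b') (l2span_op s'0 IH)) => n _.
  by rewrite /b' dcombB /= [dilcomb s' b n]dcomb_scal; ring.
apply: l2span_lim => eps e0.
have [|J hJ] := @expr_small (weight s ^+ 2) K _ _ e0.
  by rewrite sqr_ge0 expr_lt1 ?wt_ge0.
exists (fun n => b n - y J n) => // N.
rewrite (eq_nrm _ (g := y J)); last by move=> n _; rewrite opprB addrC subrK.
exact: le_trans (ny J N) hJ.
Qed.

Definition rough P n := all (fun p => P <= p)%N (primes n).

Lemma sum_inv_sqr P N : (1 < P)%N ->
  \sum_(1 <= n < N.+1) (if (P <= n)%N then (n%:R ^- 1) ^+ 2 else 0) <= (P.-1)%:R^-1 :> R.
Proof.
move=> P1.
(* Subtracting 1/N makes the induction telescope through 1/n^2 <= 1/(n-1) - 1/n. *)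
suff h : \sum_(1 <= n < N.+1) (if (P <= n)%N then (n%:R ^- 1) ^+ 2 else 0) <=
         (if (P <= N)%N then (P.-1)%:R^-1 - N%:R^-1 else 0) :> R.
  apply: le_trans h _; case: ifP => _; last by rewrite invr_ge0.
  by rewrite gerBl invr_ge0.
elim: N => [|N IH]; first by rewrite big_nil; case: ifP => //; lia.
rewrite big_nat_recr //=; apply: le_trans (lerD IH (lexx _)) _.
have [PN|NP] := leqP P N.
  rewrite (leqW PN) expr1 -addrA lerD2l.
  have N0 : 0 < N%:R :> R by rewrite ltr0n; lia.
  have N1 : 0 < N.+1%:R :> R by rewrite ltr0n.
  rewrite -subr_ge0 (_ : _ - _ = N%:R^-1 * (N.+1%:R^-1) ^+ 2).
    by rewrite mulr_ge0 ?invr_ge0 ?sqr_ge0 // ltW.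
  by rewrite -natr1; field; rewrite natr1 !gt_eqF.
case: ifPn => [PN1|]; last by rewrite addr0.
have -> : P = N.+1 by lia.
rewrite expr1 add0r /=.
have N0 : 0 < N%:R :> R by rewrite ltr0n; lia.
have N1 : 0 < N.+1%:R :> R by rewrite ltr0n.
rewrite -subr_ge0 (_ : _ - _ = N%:R^-1 * (N.+1%:R^-1) ^+ 2).
  by rewrite mulr_ge0 ?invr_ge0 ?sqr_ge0 // ltW.
by rewrite -natr1; field; rewrite natr1 !gt_eqF.
Qed.

Variable g : nat -> C.
Hypothesis gM : forall m n, g (m * n) = g m * g n.
Hypothesis g1 : g 1 = 1.
Hypothesis gle : forall n, (0 < n)%N -> normc (g n) <= n%:R^-1.

Let grough P n := if rough P n then g n else 0.

(** For prime P, the operator 1 - g(P) D_P deletes exactly the multiples of P: g is completely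
    multiplicative, and mP is P-rough if and only if m is. For other P, being rough for P and for P
    + 1 is the same. *)
Lemma l2span_rough P : l2span g (grough P).
Proof.
elim: P => [|P IH].
  apply: eq_Cl (l2span_refl g) => n _; rewrite /grough (_ : rough 0 n) //.
  by apply/allP.
have [pp|np] := boolP (prime P); last first.
  apply: eq_Cl IH => n _; rewrite /grough; congr (if _ then _ else _).
  apply/allP/allP => h p pn; last by apply: ltnW; apply: h.
  have := h p pn; rewrite leq_eqVlt => /predU1P[Pp|//].
  by move: pn np; rewrite mem_primes Pp => /andP[->].
apply: eq_Cl (l2span_lin (- g P) (l2span_dil (prime_gt0 pp) IH) IH) => n n0.
rewrite /dilate /grough; case: ifPn => [/dvdnP[m nm]|Pn].
  have m0 : (0 < m)%N by move: n0; rewrite nm; case: (m).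
  rewrite nm mulnK ?prime_gt0 //.
  have -> : rough P (m * P) = rough P m.
    have P0 := prime_gt0 pp.
    apply/allP/allP => h p; last first.
      rewrite primesM // (primes_prime pp) => /orP[/h//|].
      by rewrite inE => /eqP ->.
    by move=> pm; apply: h; rewrite primesM // pm.
  have -> : rough P.+1 (m * P) = false.
    have P0 := prime_gt0 pp.
    apply/negP => /allP /(_ P); rewrite ltnn => h.
    suff : false by []. apply: h.
    by rewrite primesM // (primes_prime pp) mem_head orbT.
  by case: ifP => _; rewrite ?gM; ring.
rewrite mulr0 add0r; congr (if _ then _ else _).
apply/allP/allP => h p pn; last by apply: ltnW; apply: h.
have := h p pn; rewrite leq_eqVlt => /predU1P[Pp|//].
by move: pn Pn; rewrite mem_primes Pp => /and3P[_ _ ->].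
Qed.

(* Sieving out one Euler factor at a time leaves the P-rough part of [g], which
   differs from the Kronecker sequence by a tail of size O(1/P). *)
Lemma l2span_euler : l2span g (@kronecker R).
Proof.
apply: l2span_lim => eps e0.
(* The shift by 2 makes 1/(P-1) < eps, the tail bound supplied by [sum_inv_sqr]. The least prime
   factor of a rough n > 1 is at least P, so n itself is. *)
pose P := (Num.truncn eps^-1).+2.
have hP : eps^-1 < (P.-1)%:R by apply: truncnS_gt.
exists (grough P); first exact: l2span_rough.
move=> N; apply: (@le_trans _ _ (P.-1)%:R^-1); last first.
  by rewrite -[eps]invrK lef_pV2 ?posrE ?invr_gt0 ?ltr0n // ltW.
have P1 : (1 < P)%N by [].
apply: le_trans (sum_inv_sqr N P1); rewrite /sqnorm [X in X <= _]big_nat [X in _ <= X]big_nat.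
apply: ler_sum => n /andP[n0 _]; rewrite /kronecker /grough.
have [->|n1] := eqVneq n 1%N.
  by rewrite g1 (_ : rough _ _) ?subrr ?ComplexField.Normc.normc0 ?expr0n //; case: ifP; rewrite ?sqr_ge0.
have n2 : (1 < n)%N by lia.
rewrite sub0r normcN; case: ifPn => [rn|_]; last first.
  by rewrite ComplexField.Normc.normc0 expr0n /=; case: ifP => // _; rewrite sqr_ge0.
have pn : pdiv n \in primes n by rewrite mem_primes pdiv_prime // n0 pdiv_dvd.
have Pn : (P <= n)%N.
  by apply: leq_trans (allP rn _ pn) _; apply: dvdn_leq (pdiv_dvd n).
rewrite Pn; rewrite ler_sqr ?nnegrE ?invr_ge0 ?normc_ge0 //; first by rewrite gle.
Qed.

End Invertibility.

(** * Finite Fourier transforms *)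

Section FiniteFourier.
Variable R : realType.
Local Notation C := R[i].
Implicit Types (h : nat -> C) (j k m n p N : nat).

Definition cis (t : R) : C := (cos (2 * pi * t) +i* sin (2 * pi * t))%C.

Lemma cisD s t : cis (s + t) = cis s * cis t.
Proof.
apply/eqP; rewrite eq_complex /= mulrDr cosD sinD; apply/andP; split; apply/eqP; ring.
Qed.

Lemma cis_nat n : cis n%:R = 1.
Proof.
have -> : cis n%:R = (cos (0 + (pi *+ 2) *+ n) +i* sin (0 + (pi *+ 2) *+ n))%C.
  by rewrite /cis !add0r (mulr_natl pi 2) mulr_natr.
rewrite (periodicn (@cosD2pi R)) (periodicn (@sinD2pi R)) cos0 sin0.
by apply/eqP; rewrite eq_complex /= !eqxx.
Qed.

Lemma cisDn t n : cis (t + n%:R) = cis t.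
Proof. by rewrite cisD cis_nat mulr1. Qed.

Lemma cis_neq1 t : 0 < t < 1 -> cis t != 1.
Proof.
move=> /andP[t0 t1]; apply/eqP => /(congr1 (@complex.Re R)) /=.
rewrite (_ : 2 * pi * t = (pi * t) *+ 2); last by ring.
rewrite cos_mulr2n.
have : 0 < sin (pi * t).
  by apply: sin_gt0_pi; rewrite mulr_gt0 ?pi_gt0 //= gtr_pMr ?pi_gt0.
have := cos2Dsin2 (pi * t); move: (cos _) (sin _) => x y; nra.
Qed.

Lemma cis_frac_mod j N : (0 < N)%N -> cis (j%:R / N%:R) = cis ((j %% N)%:R / N%:R).
Proof.
move=> N0; have N0' : N%:R != 0 :> R by rewrite pnatr_eq0; case: (N) N0.
rewrite {1}(divn_eq j N) natrD natrM mulrDl mulfK // addrC; exact: cisDn.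
Qed.

Lemma sum_cis p j : (0 < p)%N ->
  \sum_(0 <= t < p) cis ((j * t)%:R / p%:R) = if (p %| j)%N then p%:R else 0.
Proof.
move=> p0; have p0' : p%:R != 0 :> R by rewrite pnatr_eq0; case: (p) p0.
have cX t : cis ((j * t)%:R / p%:R) = cis (j%:R / p%:R) ^+ t.
  elim: t => [|t IH]; first by rewrite muln0 mul0r (cis_nat 0) expr0.
  by rewrite mulnS natrD mulrDl cisD IH exprS.
rewrite (eq_bigr _ (fun t _ => cX t)).
case: ifPn => pj.
  have -> : cis (j%:R / p%:R) = 1.
    by rewrite cis_frac_mod // (eqP pj) mul0r (cis_nat 0).
  rewrite (eq_bigr (fun=> 1)) => [|t _]; last by rewrite expr1n.
  by rewrite sumr_const_nat subn0.
have z1 : cis (j%:R / p%:R) - 1 != 0.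
  rewrite subr_eq0 cis_frac_mod // cis_neq1 //.
  rewrite divr_gt0 ?ltr0n // ?lt0n //= ltr_pdivrMr ?ltr0n // mul1r ltr_nat.
  exact: ltn_pmod.
apply: (mulfI z1); rewrite mulr0 big_mkord -subrX1 -cX.
by rewrite natrM mulfK // cis_nat subrr.
Qed.

Lemma sum_nat_mulnl (F : nat -> C) p N :
  \sum_(0 <= m < p * N) F m = \sum_(0 <= t < p) \sum_(0 <= r < N) F (t * N + r)%N.
Proof.
elim: p => [|p IH]; first by rewrite mul0n !big_nil.
rewrite big_nat_recr //= -IH mulSnr (big_cat_nat (leq0n _) (leq_addr _ _)) /=.
congr (_ + _); rewrite -{1}[(p * N)%N]add0n big_addn addKn.
by apply: eq_bigr => r _; rewrite addnC.
Qed.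

Definition nperiodic N h := forall m, h (m + N)%N = h m.

Lemma nperiodicM N h t m : nperiodic N h -> h (m + t * N)%N = h m.
Proof. by move=> hN; elim: t => [|t IH]; rewrite ?addn0 // mulSn addnCA addnC hN. Qed.

Lemma nperiodic_modn N h m : nperiodic N h -> h (m %% N)%N = h m.
Proof. by move=> hN; rewrite {2}(divn_eq m N) addnC nperiodicM. Qed.

Lemma nperiodic_mod N h a b : nperiodic N h -> a = b %[mod N] -> h a = h b.
Proof. by move=> hN ab; rewrite -(nperiodic_modn a hN) ab nperiodic_modn. Qed.

(** Positive exponent and no normalisation, so [dft q psi 1] is the classical Gauss sum. *)
Definition dft N h j : C := \sum_(0 <= m < N) h m * cis ((j * m)%:R / N%:R).

(** Write m = tN + r: the sum over t is a complete sum of p-th roots of unity, which vanishes unless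
    p divides j. *)
Lemma ft_mull p N h j : (0 < p)%N -> (0 < N)%N -> nperiodic N h ->
  dft (p * N) h j = if (p %| j)%N then p%:R * dft N h (j %/ p) else 0.
Proof.
move=> p0 N0 hN.
have p0' : p%:R != 0 :> R by rewrite pnatr_eq0; case: (p) p0.
have N0' : N%:R != 0 :> R by rewrite pnatr_eq0; case: (N) N0.
rewrite /dft sum_nat_mulnl exchange_big /=.
transitivity (\sum_(0 <= r < N) h r * cis ((j * r)%:R / (p * N)%:R) *
   \sum_(0 <= t < p) cis ((j * t)%:R / p%:R)).
  apply: eq_bigr => r _; rewrite mulr_sumr; apply: eq_bigr => t _.
  rewrite addnC nperiodicM // -mulrA -cisD; congr (_ * cis _).
  by rewrite !natrM !natrD !natrM; field; rewrite p0' N0'.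
rewrite sum_cis // -mulr_suml; case: ifPn => [/dvdnP[k ->]|_]; last by rewrite mulr0.
rewrite mulrC mulnK //; congr (_ * _); apply: eq_bigr => r _; congr (_ * cis _).
by rewrite !natrM; field; rewrite p0' N0'.
Qed.

Lemma ft_dvd p N h j : (0 < p)%N -> (0 < N)%N ->
  dft (p * N) (fun m => if (p %| m)%N then h m else 0) j = dft N (fun m => h (p * m)%N) j.
Proof.
move=> p0 N0.
have p0' : p%:R != 0 :> R by rewrite pnatr_eq0; case: (p) p0.
have N0' : N%:R != 0 :> R by rewrite pnatr_eq0; case: (N) N0.
rewrite /dft mulnC sum_nat_mulnl; apply: eq_bigr => m _.
case: p p0 p0' => // p p0 p0'.
rewrite big_ltn // big_nat big1 ?addr0 => [|r /andP[r0 rp]]; last first.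
  rewrite dvdn_addr ?dvdn_mull // gtnNdvd ?mul0r //.
rewrite addn0 dvdn_mull // mulnC; congr (_ * cis _).
rewrite !natrM; move: (p.+1%:R) p0' => P P0; by field; rewrite P0 N0'.
Qed.

Lemma eq_ft N h h' j : (forall m, h m = h' m) -> dft N h j = dft N h' j.
Proof. by move=> hh; apply: eq_bigr => m _; rewrite hh. Qed.

Lemma ftZ N c h j : dft N (fun m => c * h m) j = c * dft N h j.
Proof. by rewrite /dft mulr_sumr; apply: eq_bigr => m _; rewrite mulrA. Qed.

Lemma ftB N h h' j : dft N (fun m => h m - h' m) j = dft N h j - dft N h' j.
Proof. by rewrite /dft -sumrB; apply: eq_bigr => m _; rewrite mulrBl. Qed.

Lemma modn_cancel a m n q : coprime a q -> a * m = a * n %[mod q] -> m = n %[mod q].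
Proof.
have [->|q0] := posnP q; first by rewrite /coprime gcdn0 !modn0 => /eqP ->; rewrite !mul1n.
move=> aq amn; have t0 : (0 < totient q)%N by rewrite totient_gt0.
(* By Euler's theorem this power of a is its inverse mod q. *)
have E x : a ^ (totient q).-1 * (a * x) = x %[mod q].
  rewrite mulnA -expnSr prednK // -modnMml cyclic.Euler_exp_totient // modnMml.
  by rewrite mul1n.
by rewrite -(E m) -(E n) -modnMmr amn modnMmr.
Qed.

Lemma sum_perm_mulr q a h : coprime a q -> nperiodic q h ->
  \sum_(0 <= m < q) h (a * m)%N = \sum_(0 <= m < q) h m.
Proof.
move=> aq hq; case: q aq hq => [|q] aq hq; first by rewrite !big_nil.
rewrite !big_mkord.
have fP (m : 'I_q.+1) : ((a * m) %% q.+1 < q.+1)%N by rewrite ltn_pmod.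
pose f (m : 'I_q.+1) := Ordinal (fP m).
have finj : injective f.
  move=> m n [] /(modn_cancel aq); rewrite !modn_small // => mn; exact: val_inj.
rewrite [RHS](reindex_inj finj) /=.
by apply: eq_bigr => m _; rewrite nperiodic_modn.
Qed.

End FiniteFourier.

(** * Dirichlet characters *)

Section Characters.
Variable R : realType.
Local Notation C := R[i].
Implicit Types (j k m n p N q d : nat) (chi : nat -> C).

Section Basic.
Variables (q : nat) (chi : nat -> C).
Hypothesis chiP : dirichlet_char q chi.

Lemma chiM m n : chi (m * n) = chi m * chi n.
Proof. by case: chiP. Qed.

Lemma chi_periodic : nperiodic q chi.
Proof. by case: chiP. Qed.

Lemma chi_neq0 n : (chi n != 0) = coprime n q.
Proof. by apply/idP/idP; case: chiP => _ _ /(_ n) [] //. Qed.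

Lemma chi_eq0 n : ~~ coprime n q -> chi n = 0.
Proof. by rewrite -chi_neq0 negbK => /eqP. Qed.

Lemma chi1 : chi 1 = 1.
Proof.
have c1 : chi 1 != 0 by rewrite chi_neq0 coprime1n.
by apply: (mulfI c1); rewrite -chiM mulr1.
Qed.

Lemma chiX m n : chi (m ^ n)%N = chi m ^+ n.
Proof. by elim: n => [|n IH]; rewrite ?expn0 ?chi1 // expnS exprS chiM IH. Qed.

Lemma chi_mod m n : m = n %[mod q] -> chi m = chi n.
Proof. exact: (nperiodic_mod chi_periodic). Qed.

(** Euler's theorem makes chi(n) a root of unity. *)
Lemma normc_chi n : (0 < q)%N -> coprime n q -> normc (chi n) = 1.
Proof.
move=> q0 nq; have t0 : (0 < totient q)%N by rewrite totient_gt0.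
apply/eqP; rewrite -(pexpr_eq1 t0) ?normc_ge0 // -normcX -chiX.
by rewrite (chi_mod (cyclic.Euler_exp_totient nq)) chi1 ComplexField.Normc.normc1.
Qed.

End Basic.

(** Surjectivity of the reduction map from units mod q to units mod d. *)
Lemma coprime_lift n d q : (0 < q)%N -> (d %| q)%N -> coprime n d ->
  exists2 x, coprime x q & x = n %[mod d].
Proof.
move=> q0 dq nd; have d0 : (0 < d)%N by apply: dvdn_gt0 dq.
have [nq0|n0] := posnP (n + d); first by lia.
(* t is the part of q prime to n + d. A prime p of q dividing n + d divides neither d nor t; any
   other prime of q divides t but not n + d. So none divides n + d + dt. Using n + d in place of n
   keeps the number positive when n = 0. *)
pose t := (q`_(\pi(n + d)^'))%N.
have t0 : (0 < t)%N by apply: part_gt0.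
exists (n + d + d * t)%N; last by rewrite mulnC addnC modnMDl modnDr.
have x0 : (0 < n + d + d * t)%N by rewrite addn_gt0 n0.
rewrite coprime_has_primes //; apply/hasPn => p.
rewrite mem_primes => /and3P[pp _ pq]; apply/negP.
rewrite mem_primes pp x0 /= => px.
have [pn|pn] := boolP (p %| n + d)%N.
  have pdt : (p %| d * t)%N by rewrite -(dvdn_addr _ pn).
  have npd : ~~ (p %| d)%N.
    apply/negP => pd; have pn' : (p %| n)%N by rewrite -(dvdn_addl _ pd).
    by move: nd; rewrite /coprime => /eqP g1; have := dvdn_gcd p n d; rewrite g1 pn' pd dvdn1 => /eqP p1; rewrite p1 in pp.
  move: pdt; rewrite Euclid_dvdM // (negPf npd) /= => pt.
  have : p \in \pi(t) by rewrite mem_primes pp t0.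
  by move/(pnatPpi (part_pnat _ _)); rewrite !inE mem_primes pp n0 pn.
have pt : (p %| t)%N.
  have pp' : p \in \pi(n + d)^' by rewrite !inE mem_primes pp n0 (negPf pn).
  have pE : (p`_(\pi(n + d)^'))%N = p by apply: part_pnat_id; rewrite pnatE.
  by rewrite -pE; apply: partn_dvd.
by move: px; rewrite dvdn_addl ?(negPf pn) // dvdn_mull.
Qed.

Lemma mod_inverse y q : (0 < q)%N -> coprime y q ->
  exists2 z, coprime z q & y * z = 1 %[mod q].
Proof.
move=> q0 yq; have t0 : (0 < totient q)%N by rewrite totient_gt0.
exists (y ^ (totient q).-1)%N; first by rewrite coprimeXl.
by rewrite -expnS prednK // cyclic.Euler_exp_totient.
Qed.

Lemma mod_dvdn a b d q : (d %| q)%N -> a = b %[mod q] -> a = b %[mod d].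
Proof. by move=> dq ab; rewrite -(modn_dvdm a dq) ab modn_dvdm. Qed.

(* If [chi] were trivial on the units congruent to 1 mod d, transporting it along
   [coprime_lift] would give a character mod d inducing it. *)
Lemma primitive_witness chi q d : (0 < q)%N -> primitive_char q chi ->
  (d %| q)%N -> d != q ->
  exists a, [/\ coprime a q, a = 1 %[mod d] & chi a <> 1].
Proof.
move=> q0 [chiP prim] dq dneq; apply: contrapT => nex; apply: prim.
have triv a : coprime a q -> a = 1 %[mod d] -> chi a = 1.
  by move=> aq a1; apply: contrapT => ca; apply: nex; exists a.
have same x y : coprime x q -> coprime y q -> x = y %[mod d] -> chi x = chi y.
  move=> xq yq xy; have [z zq yz] := mod_inverse q0 yq.
  have z0 : chi z != 0 by rewrite (chi_neq0 chiP).
  have e1 : chi (x * z)%N = 1.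
    apply: triv; first by rewrite coprimeMl xq.
    by rewrite -modnMml xy modnMml (mod_dvdn dq yz).
  apply: (mulIf z0); rewrite -!(chiM chiP) e1.
  by rewrite (chi_mod chiP yz) (chi1 chiP).
have liftP n : exists x, coprime n d -> coprime x q /\ x = n %[mod d].
  have [nd|nd] := boolP (coprime n d); last by exists 0%N.
  by have [x xq xn] := coprime_lift q0 dq nd; exists x.
have [l lP] := choice liftP.
pose th n := if coprime n d then chi (l n) else 0.
have cd n : coprime n q -> coprime n d by apply: coprime_dvdr.
exists d; split => //; exists th; split; last first.
  move=> n; case: ifPn => nq; last by rewrite mulr0 (chi_eq0 chiP).
  rewrite mulr1 /th cd //; have [lq ln] := lP _ (cd _ nq).
  by apply: same => //.
split.
- move=> m n; rewrite /th coprimeMl.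
  have [md|md] := boolP (coprime m d); last by rewrite mul0r.
  have [nd|nd] := boolP (coprime n d); last by rewrite mulr0.
  have [mq mm] := lP _ md; have [nq nn] := lP _ nd.
  have [|pq pp] := lP (m * n)%N; first by rewrite coprimeMl md.
  rewrite -(chiM chiP); apply: same => //; first by rewrite coprimeMl mq.
  by rewrite pp -modnMml -mm modnMml -modnMmr -nn modnMmr.
- move=> n; rewrite /th; have E : coprime (n + d) d = coprime n d.
    by rewrite -coprime_modl modnDr coprime_modl.
  rewrite E; case: ifPn => // nd; have [nq nn] := lP _ nd.
  have [|pq pp] := lP (n + d)%N; first by rewrite E.
  by apply: same => //; rewrite pp nn modnDr.
- move=> n; rewrite /th; case: ifPn => nd; last by rewrite eqxx.
  by have [nq nn] := lP _ nd; rewrite (chi_neq0 chiP); split.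
Qed.

Section Gauss.
Variables (q : nat) (chi : nat -> C).
Hypothesis q1 : (1 < q)%N.
Hypothesis primP : primitive_char q chi.

Let q0 : (0 < q)%N. Proof. exact: ltnW. Qed.
Let chiP : dirichlet_char q chi. Proof. by case: primP. Qed.

Lemma periodic_ft_term j :
  nperiodic q (fun m => chi m * cis ((j * m)%:R / q%:R)).
Proof.
move=> m; rewrite (chi_periodic chiP) cis_frac_mod //.
by rewrite [in RHS]cis_frac_mod // mulnDr -modnDmr modnMl addn0.
Qed.

Lemma gauss_coprime j : coprime j q -> chi j * dft q chi j = dft q chi 1.
Proof.
move=> jq; rewrite -[RHS](sum_perm_mulr jq (periodic_ft_term 1)).
rewrite mulr_sumr; apply: eq_bigr => m _.
by rewrite mulrA -(chiM chiP) mul1n.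
Qed.

(** Let d = q / gcd(j, q), a proper divisor of q. A unit a congruent to 1 mod d satisfies jam = jm
    mod q, so the substitution m -> am shows that chi(a) fixes the sum; primitivity provides such an
    a with chi(a) different from 1. *)
Lemma gauss_ncoprime j : ~~ coprime j q -> dft q chi j = 0.
Proof.
move=> jq; pose g := gcdn j q; pose d := (q %/ g)%N.
have g0 : (0 < g)%N by rewrite gcdn_gt0 q0 orbT.
have gq : (g %| q)%N := dvdn_gcdr j q.
have dq : (d %| q)%N by rewrite /d dvdn_divLR // dvdn_mulr.
have dneq : d != q.
  apply/eqP => dE; move: jq; rewrite /coprime -/g; case/negP.
  by have := divnK gq; rewrite -/d dE; nia.
have [a [aq a1 ca]] := primitive_witness q0 primP dq dneq.
have a0 : (0 < a)%N.
  by rewrite lt0n; apply/eqP => a0; move: aq q1; rewrite a0 /coprime gcd0n => /eqP ->.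
have E : chi a * dft q chi j = dft q chi j.
  rewrite -[RHS](sum_perm_mulr aq (periodic_ft_term j)).
  rewrite mulr_sumr; apply: eq_bigr => m _.
  rewrite mulrA -(chiM chiP); congr (_ * _).
  rewrite cis_frac_mod // [RHS]cis_frac_mod //; congr (cis (_%:R / _)).
  apply/esym/eqP; rewrite mulnCA mulnC eqn_mod_dvd ?leq_pmulr //.
  rewrite -{2}[(j * m)%N]muln1 -mulnBr.
  have d1 : (d %| a - 1)%N by rewrite -eqn_mod_dvd //; apply/eqP.
  case/dvdnP: d1 => k ->; apply/dvdnP; exists (j %/ g * m * k)%N.
  have jE := divnK (dvdn_gcdl j q); have qE := divnK gq.
  rewrite -/g in jE; rewrite -/d in qE; rewrite -{1}jE -qE; ring.
have : (chi a - 1) * dft q chi j = 0 by rewrite mulrBl mul1r E subrr.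
by move/eqP; rewrite mulf_eq0 subr_eq0 => /orP[/eqP//|/eqP].
Qed.

Lemma gaussE j : dft q chi j = (chi j)^-1 * dft q chi 1.
Proof.
have [jq|jq] := boolP (coprime j q).
  by rewrite -(gauss_coprime jq) mulKf // (chi_neq0 chiP).
by rewrite gauss_ncoprime // (chi_eq0 chiP jq) invr0 mul0r.
Qed.

(** Fourier inversion at m = 1, with q - 1 in the role of -1: the transforms weighted by exp(-2 pi i
    j/q) sum to q chi(1) = q. By [gaussE] all of them would vanish together with the Gauss sum. *)
Lemma gauss_neq0 : dft q chi 1 != 0.
Proof.
apply/eqP => G0.
have H : \sum_(0 <= j < q) dft q chi j * cis ((j * q.-1)%:R / q%:R) = q%:R.
  transitivity (\sum_(0 <= m < q) chi m *
     \sum_(0 <= j < q) cis (((m + q.-1) * j)%:R / q%:R)).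
    rewrite (eq_bigr (fun j => \sum_(0 <= m < q) chi m * cis (((m + q.-1) * j)%:R / q%:R))).
      by rewrite exchange_big /=; apply: eq_bigr => m _; rewrite mulr_sumr.
    move=> j _; rewrite mulr_suml; apply: eq_bigr => m _.
    by rewrite -mulrA -cisD -mulrDl -natrD mulnDl (mulnC j) (mulnC j).
  rewrite (big_rem 1%N) /=; last by rewrite mem_index_iota q1.
  rewrite sum_cis // add1n prednK // dvdnn (chi1 chiP) mul1r big1_seq ?addr0 //.
  move=> m /andP[_ mr]; rewrite sum_cis //.
  have := mem_rem mr; rewrite mem_index_iota => /andP[_ mq].
  have m1 : m != 1%N by apply: contraTneq mr => ->; rewrite mem_rem_uniqF ?iota_uniq.
  case: ifPn => [/dvdnP[k kq]|]; last by rewrite mulr0.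
  by exfalso; case: k kq => [|[|k]]; rewrite ?mulSn; lia.
move: H; rewrite big1 => [/esym/eqP|j _]; first by rewrite pnatr_eq0; lia.
by rewrite gaussE G0 mulr0 mul0r.
Qed.

End Gauss.

End Characters.

Lemma prime_ind (P : nat -> Prop) : P 1%N ->
  (forall p n, prime p -> (0 < n)%N -> P n -> P (p * n)%N) ->
  forall n, (0 < n)%N -> P n.
Proof.
move=> P1 PM n; have [m] := ubnP n; elim: m n => // m IH n nm n0.
have [n1|n1] := leqP n 1; first by have -> : n = 1%N by lia.
have pp := pdiv_prime n1; rewrite -(divnK (pdiv_dvd n)) mulnC.
have d0 : (0 < n %/ pdiv n)%N by rewrite divn_gt0 ?prime_gt0 // dvdn_leq ?pdiv_dvd.
apply: PM => //; apply: IH => //.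
by apply: leq_trans (ltn_Pdiv (prime_gt1 pp) n0) _.
Qed.

(** * Gauss sums of imprimitive characters *)

Section GaussSums.
Variable R : realType.
Local Notation C := R[i].
Implicit Types (j k m n p N d : nat).
Variables (q : nat) (psi : nat -> C).
Hypothesis q1 : (1 < q)%N.
Hypothesis primP : primitive_char q psi.

Let q0 : (0 < q)%N. Proof. exact: ltnW. Qed.
Let psiP : dirichlet_char q psi. Proof. by case: primP. Qed.

Definition restrict_char n m : C := if coprime m n then psi m else 0.

Definition gauss_sum n j : C := dft (n * q) (restrict_char n) j.

Lemma restr_periodic n : nperiodic (n * q) (restrict_char n).
Proof.
move=> m; rewrite /restrict_char (nperiodicM _ _ (chi_periodic psiP)).
by rewrite -coprime_modl mulnC addnC modnMDl coprime_modl.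
Qed.

Lemma gsum1 j : gauss_sum 1 j = (psi j)^-1 * dft q psi 1.
Proof.
rewrite /gauss_sum mul1n -(gaussE q1 primP j); apply: eq_ft => m.
by rewrite /restrict_char coprimen1.
Qed.

(** Passing from n to pn discards the multiples of p. The undiscarded sum, now over p periods, is
    the first term by [ft_mull]; the discarded part is psi(p) [gauss_sum n j] by [ft_dvd]. If p
    divides n, these multiples were already absent. *)
Lemma gsum_mulp p n j : prime p -> (0 < n)%N ->
  gauss_sum (p * n) j = (if (p %| j)%N then p%:R * gauss_sum n (j %/ p) else 0) -
                   (if (p %| n)%N then 0 else psi p * gauss_sum n j).
Proof.
move=> pp n0; have p0 := prime_gt0 pp.
have nq0 : (0 < n * q)%N by rewrite muln_gt0 n0.
rewrite {1}/gauss_sum -mulnA.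
rewrite -(ft_mull _ p0 nq0 (@restr_periodic n)).
case: ifPn => pn.
  rewrite subr0; apply: eq_ft => m; rewrite /restrict_char coprimeMr; case: ifPn => [/andP[_ ->]//|].
  rewrite negb_and; case: (boolP (coprime m n)) => // mn; rewrite orbF => mp.
  case/negP: mp; case/dvdnP: pn => k nk; move: mn; rewrite nk coprimeMr; by case/andP.
rewrite -ftZ -[X in _ - X](_ : dft (p * (n * q))
  (fun m => if (p %| m)%N then restrict_char n m else 0) j = _); last first.
  rewrite ft_dvd //; apply: eq_ft => m; rewrite /restrict_char coprimeMl.
  by rewrite prime_coprime // pn /=; case: ifP => _; rewrite ?(chiM psiP) ?mulr0.
rewrite -ftB; apply: eq_ft => m; rewrite /restrict_char coprimeMr coprime_sym prime_coprime //.
by case: (p %| m)%N => /=; case: ifP => _; rewrite ?subrr ?subr0.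
Qed.

(** The mean value of the restricted character; it will cancel the endpoint 1 shared by all
    intervals in S_n. *)
Lemma gsum0 n : (0 < n)%N -> gauss_sum n 0 = 0.
Proof.
move: n; apply: prime_ind => [|p n pp n0 IH].
  by rewrite gsum1 (chi_eq0 psiP) ?invr0 ?mul0r // /coprime gcd0n gtn_eqF.
by rewrite gsum_mulp // dvdn0 div0n IH !mulr0 sub0r; case: ifP; rewrite ?oppr0.
Qed.

Hypothesis psi_even : psi q.-1 = 1.

Lemma coprime_compl x m n : (x + m = n * q)%N -> coprime x n = coprime m n.
Proof.
suff h a b : (a + b = n * q)%N -> coprime a n -> coprime b n.
  move=> xm; apply/idP/idP; first exact: h.
  by apply: h; rewrite addnC.
move=> ab an; have : (gcdn b n %| gcdn a n)%N.
  rewrite dvdn_gcd dvdn_gcdr andbT -(dvdn_addl _ (dvdn_gcdl b n)) ab.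
  by rewrite dvdn_mulr // dvdn_gcdr.
by rewrite (eqP an) dvdn1.
Qed.

(** Evenness enters here: x = -m mod q, and multiplication by q - 1 stands for the sign. *)
Lemma restr_compl n x m : (x + m = n * q)%N -> restrict_char n x = restrict_char n m.
Proof.
move=> xm; rewrite /restrict_char (coprime_compl xm); case: ifP => // _.
rewrite -[psi m]mul1r -psi_even -(chiM psiP); apply: (chi_mod psiP).
apply/eqP; rewrite -(eqn_modDr m) xm modnMl.
have -> : (q.-1 * m + m = q * m)%N by rewrite -mulSnr prednK.
by rewrite modnMr.
Qed.

(** A nonzero value would make m coprime to nq = 2m, so m = 1 and q = 2; but there is no primitive
    character mod 2, since every unit is 1 there. *)
Lemma restr_half n m : (0 < n)%N -> (2 * m = n * q)%N -> restrict_char n m = 0.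
Proof.
move=> n0 mM; rewrite /restrict_char; case: ifPn => // mn.
apply: (chi_eq0 psiP); apply/negP => mq.
have : coprime m (2 * m)%N by rewrite mM coprimeMr mn.
rewrite coprimeMr => /andP[_]; rewrite /coprime gcdnn => /eqP m1.
have q2 : q = 2%N by move: mM; rewrite m1; nia.
have [|a [aq _ ca]] := primitive_witness q0 primP (dvd1n q); first by rewrite q2.
apply: ca; rewrite -(chi1 psiP); apply: (chi_mod psiP).
move: aq; rewrite q2 coprimen2 !modn2 => -> //.
Qed.

Lemma cis_compl (t : R) n : cis t + cis (n%:R - t) = ((2 * cos (2 * pi * t))%:C)%C.
Proof.
rewrite addrC [n%:R - t]addrC cisDn; apply/eqP; rewrite eq_complex /cis /=.
rewrite mulrN cosN sinN; apply/andP; split; apply/eqP; ring.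
Qed.

(* [m] is paired with [nq - m]; the possible middle term m = nq/2 vanishes. *)
Lemma half_sum n j : (0 < n)%N ->
  \sum_(1 <= m < ((n * q).-1 %/ 2).+1 | coprime m n)
     psi m * ((2 * cos (2 * pi * ((j * m)%:R / (n * q)%:R)))%:C)%C = gauss_sum n j.
Proof.
move=> n0; set M := (n * q)%N; set h := (M.-1 %/ 2)%N.
have M0 : (0 < M)%N by rewrite muln_gt0 n0.
have M0' : M%:R != 0 :> R by rewrite pnatr_eq0 -lt0n.
pose F m := restrict_char n m * cis ((j * m)%:R / M%:R).
have Fc x m : (x + m = M)%N -> F m + F x = restrict_char n m * ((2 * cos (2 * pi * ((j * m)%:R / M%:R)))%:C)%C.
  move=> xm; rewrite /F (restr_compl xm) -mulrDr -(cis_compl _ j); congr (_ * (_ + cis _)).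
  have -> : x = (M - m)%N by lia.
  have jmM : (j * m <= j * M)%N by rewrite leq_mul2l; apply/orP; right; lia.
  by rewrite mulnBr natrB // mulrBl natrM mulfK.
have F0 : F 0%N = 0.
  by rewrite /F /restrict_char (chi_eq0 psiP) ?if_same ?mul0r // /coprime gcd0n gtn_eqF.
rewrite /gauss_sum /dft -/M -[RHS]/(\sum_(0 <= m < M) F m).
rewrite big_ltn // F0 add0r.
have hM : (h.+1 <= M)%N by rewrite /h; lia.
rewrite [RHS](@big_cat_nat _ _ _ h.+1) //=.
transitivity (\sum_(1 <= m < h.+1) F m + \sum_(1 <= m < h.+1) F (M - m)%N).
  rewrite -big_split /= big_mkcond /=; apply: eq_big_nat => m /andP[m1 mh].
  rewrite Fc; last by rewrite subnK //; lia.
  by rewrite /restrict_char; case: ifP => _; rewrite ?mul0r.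
congr (_ + _); rewrite [RHS]big_nat_rev /=.
have -> : \sum_(h.+1 <= i < M) F (h.+1 + M - i.+1)%N = \sum_(1 <= i < (M - h)%N) F (M - i)%N.
  rewrite -(addn1 h) [in LHS]addnC big_addn; apply: eq_big_nat => i /andP[i1 iM].
  by congr F; lia.
(* The cases nq odd and nq even; in the second the reflected half has one more term, at index h + 1
   = nq/2. *)
have [E|E] : (M - h = h.+1)%N \/ (M - h = h.+2)%N by rewrite /h; lia.
  by rewrite E.
rewrite E [RHS]big_nat_recr //= -[LHS]addr0; congr (_ + _).
have -> : (M - h.+1 = h.+1)%N by lia.
by rewrite /F restr_half ?mul0r //; lia.
Qed.

End GaussSums.

(** * Counting divisors *)

Section DivisorCount.
Local Open Scope nat_scope.
Implicit Types (p k m n q u d : nat).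

Lemma prime_power_ind (P : nat -> Prop) : P 1 ->
  (forall p k m, prime p -> 0 < m -> coprime p m -> P m -> P (p ^ k * m)) ->
  forall n, 0 < n -> P n.
Proof.
move=> P1 PM n; have [b] := ubnP n; elim: b n => // b IH n nb n0.
have [n1|n1] := leqP n 1; first by have -> : n = 1 by lia.
have pp := pdiv_prime n1; have p1 := prime_gt1 pp.
have [m pm nE] := pfactor_coprime pp n0.
have k0 : 0 < logn (pdiv n) n by rewrite logn_gt0 mem_primes pp n0 pdiv_dvd.
have m0 : 0 < m by move: n0; rewrite nE; case: (m).
rewrite nE mulnC; apply: PM => //; apply: IH => //.
have p1k : pdiv n ^ 1 <= pdiv n ^ logn (pdiv n) n by rewrite leq_exp2l.
apply: (@leq_trans n); last by rewrite -ltnS.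
move: p1k nE; rewrite expn1; move: (pdiv n ^ _) => x; move: (pdiv n) p1 => y; nia.
Qed.

Lemma divisors_pfactorM p k m : prime p -> 0 < m -> coprime p m ->
  perm_eq (divisors (p ^ k * m)) [seq p ^ i * d | i <- iota 0 k.+1, d <- divisors m].
Proof.
move=> pp m0 pm; have p0 := prime_gt0 pp.
have n0 : 0 < p ^ k * m by rewrite muln_gt0 expn_gt0 p0.
have lgE i d : d \in divisors m -> logn p (p ^ i * d) = i.
  rewrite -dvdn_divisors // => dm; have d0 : 0 < d by exact: (dvdn_gt0 m0 dm).
  have pd : coprime p d by apply: coprime_dvdr dm pm.
  by rewrite lognM ?expn_gt0 ?p0 // pfactorK // (logn_coprime pd) addn0.
apply: uniq_perm; first exact: divisors_uniq.
  apply: allpairs_uniq; [exact: iota_uniq | exact: divisors_uniq |].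
  move=> _ _ /allpairsP[[i d] [_ dm ->]] /allpairsP[[j e] [_ em ->]] /= E.
  have ij : i = j by rewrite -(lgE i d dm) E lgE.
  by move/eqP: E; rewrite ij eqn_pmul2l ?expn_gt0 ?p0 // => /eqP ->.
move=> x; rewrite -dvdn_divisors //; apply/idP/allpairsP => [xn|[[i d] [ik dm ->]]].
  have x0 : 0 < x by apply: dvdn_gt0 xn.
  have [d pd xE] := pfactor_coprime pp x0.
  exists (logn p x, d); split; last by rewrite /= mulnC.
    rewrite mem_iota add0n ltnS /=.
    rewrite -(pfactorK k pp) -[logn p (p ^ k)]addn0 -(logn_coprime pm) -lognM ?expn_gt0 ?p0 //.
    exact: dvdn_leq_log.
  rewrite -dvdn_divisors //=; move: xn; rewrite xE => xn.
  have : d %| p ^ k * m by apply: dvdn_trans xn; apply: dvdn_mulr.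
  by rewrite Gauss_dvdr // coprime_sym coprimeXl.
move: ik dm; rewrite mem_iota add0n ltnS /= => ik dm.
by rewrite dvdn_mul // ?dvdn_exp2l // dvdn_divisors.
Qed.

Lemma ndiv_pfactorM p k m : prime p -> 0 < m -> coprime p m ->
  ndiv (p ^ k * m) = k.+1 * ndiv m.
Proof.
move=> pp m0 pm; rewrite /ndiv (perm_size (divisors_pfactorM k pp m0 pm)).
by rewrite size_allpairs size_iota.
Qed.

Variable q : nat.
Hypothesis q0 : 0 < q.

(** In this form the multiplicativity of u' is available as [partnM]. *)
Lemma coprime_partE u : 0 < u -> coprime_part u q = u`_(\pi(q)^').
Proof.
move=> u0; apply/eqP; rewrite eqn_leq; apply/andP; split.
  apply/bigmax_leqP_seq => d; rewrite -dvdn_divisors // => du dq.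
  have d0 : 0 < d by apply: dvdn_gt0 du.
  rewrite (_ : d = d`_(\pi(q)^')); first by apply: dvdn_leq; rewrite ?part_gt0 ?partn_dvd.
  apply/esym/part_pnat_id; apply/pnatP => // p pp pd.
  rewrite !inE mem_primes pp q0 /=; apply/negP => pq.
  by move: dq; rewrite /coprime => /eqP g1; have := dvdn_gcd p d q; rewrite g1 pd pq dvdn1 => /eqP p1; rewrite p1 in pp.
apply: (@leq_bigmax_seq _ _ _ (fun d => d)).
  by rewrite -dvdn_divisors // dvdn_part.
rewrite coprime_sym; apply/(pnat_coprime (pi := \pi(q))); last exact: part_pnat.
exact: pnat_pi.
Qed.

(** The count a(n) of squarefree divisors prime to q: each prime p of n outside q offers the choice
    of 1 or p. *)
Definition squarefree_weight n := \prod_(p <- primes n) (if coprime p q then 2 else 1).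

Lemma aw1 : squarefree_weight 1 = 1.
Proof. by rewrite /squarefree_weight big_nil. Qed.

Lemma aw_mulp p n : prime p -> 0 < n ->
  squarefree_weight (p * n) = squarefree_weight n * (if (p %| n) || ~~ coprime p q then 1 else 2).
Proof.
move=> pp n0; rewrite /squarefree_weight; have p0 := prime_gt0 pp.
have [pn|pn] := boolP (p %| n) => /=.
  rewrite muln1; congr (\prod_(p <- _) _); apply/eq_primes => r.
  rewrite primesM // (primes_prime pp) inE.
  by case: eqP => // ->; rewrite mem_primes pp n0 pn.
have : perm_eq (primes (p * n)) (p :: primes n).
  apply: uniq_perm; rewrite ?primes_uniq //= ?primes_uniq.
    by rewrite mem_primes (negPf pn) !andbF.
  by move=> r; rewrite primesM // (primes_prime pp) !inE.
move=> pE; rewrite (perm_big _ pE) big_cons mulnC; congr (_ * _); by case: coprime.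
Qed.

Lemma aw_pfactorM p k n : prime p -> 0 < n -> coprime p n ->
  squarefree_weight (p ^ k * n) = squarefree_weight n * (if (k == 0) || ~~ coprime p q then 1 else 2).
Proof.
move=> pp n0 pn; elim: k => [|k IH]; first by rewrite mul1n muln1.
have p0 := prime_gt0 pp; have n0' : 0 < p ^ k * n by rewrite muln_gt0 expn_gt0 p0.
rewrite expnS -mulnA aw_mulp // IH.
have pnE : (p %| p ^ k * n) = (k != 0).
  by rewrite Euclid_dvdM // Euclid_dvdX // dvdnn -[p %| n]negbK -prime_coprime // pn orbF lt0n.
by rewrite pnE; case: k {IH pnE n0'} => //= [|k]; case: coprime; rewrite ?muln1.
Qed.

(** Both sides are multiplicative in u. At p^k they equal 1 + 2k = d(p^(2k)) if p does not divide q,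
    and 1 + k = d(p^k) if it does. *)
Lemma sum_aw u : 0 < u -> \sum_(d <- divisors u) squarefree_weight d = ndiv (u * coprime_part u q).
Proof.
move: u; apply: prime_power_ind => [|p k m pp m0 pm IH].
  rewrite coprime_partE // partn1 muln1 (_ : divisors 1 = [:: 1]) //.
  by rewrite big_seq1 aw1.
have p0 := prime_gt0 pp; have pk0 : 0 < p ^ k by rewrite expn_gt0 p0.
rewrite (perm_big _ (divisors_pfactorM k pp m0 pm)) big_allpairs_dep.
transitivity (\sum_(i <- iota 0 k.+1)
    (\sum_(d <- divisors m) squarefree_weight d) * (if (i == 0) || ~~ coprime p q then 1 else 2)).
  apply: eq_bigr => i _; rewrite big_distrl /= big_seq [RHS]big_seq.
  apply: eq_bigr => d; rewrite -dvdn_divisors // => dm.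
  by rewrite aw_pfactorM ?(dvdn_gt0 m0 dm) // (coprime_dvdr dm).
rewrite -big_distrr /= IH coprime_partE // coprime_partE ?muln_gt0 ?pk0 // partnM //.
have pmm : coprime p (m * m`_(\pi(q)^')).
  by rewrite coprimeMr pm (coprime_dvdr (dvdn_part _ _) pm).
have mm0 : 0 < m * m`_(\pi(q)^') by rewrite muln_gt0 m0 part_gt0.
rewrite big_cons /=; have [pq|pq] := boolP (coprime p q) => /=.
  have -> : (p ^ k)`_(\pi(q)^') = p ^ k.
    apply: part_pnat_id; rewrite pnatX pnatE // !inE mem_primes pp q0 /=.
    by rewrite -prime_coprime // pq.
  rewrite mulnACA -expnD ndiv_pfactorM // mulnC; congr (_ * _).
  rewrite big_seq (eq_bigr (fun=> 2)) => [|i]; last by rewrite mem_iota; case: i.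
  by rewrite -big_seq big_const_seq count_predT size_iota iter_addn_0; lia.
have -> : (p ^ k)`_(\pi(q)^') = 1.
  apply/eqP; rewrite partn_eq1 // pnatX; apply/orP; left.
  rewrite pnatE // !inE mem_primes pp q0 /= negbK.
  by move: pq; rewrite prime_coprime // negbK.
rewrite mul1n -mulnA ndiv_pfactorM // mulnC; congr (_ * _).
rewrite (eq_bigr (fun=> 1)) => [|i _]; last by rewrite orbT.
by rewrite big_const_seq count_predT size_iota iter_addn_0; lia.
Qed.

End DivisorCount.

(** * Sine coefficients *)

Section Coefficients.
Variable R : realType.
Local Notation C := R[i].
Implicit Types (j k m n p N d : nat).
Variables (q : nat) (psi : nat -> C).
Hypothesis q1 : (1 < q)%N.
Hypothesis primP : primitive_char q psi.

Let q0 : (0 < q)%N. Proof. exact: ltnW. Qed.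
Let psiP : dirichlet_char q psi. Proof. by case: primP. Qed.

Definition sine_coef n j : C := gauss_sum q psi n j / ((pi * j%:R)%:C)%C.

Let invchar n : C := (psi n)^-1 / n%:R.

(** The Gauss sum together with the factor 1/pi. *)
Let tau : C := dft q psi 1 / (pi%:C)%C.

Lemma realC_neq0 (x : R) : x != 0 -> (x%:C)%C != 0.
Proof. by move=> x0; rewrite eq_complex /= eqxx andbT. Qed.

Lemma pi_neq0 : (pi : R) != 0.
Proof. by rewrite gt_eqF // pi_gt0. Qed.

Let tau_neq0 : tau != 0.
Proof. by rewrite mulf_neq0 ?invr_neq0 ?realC_neq0 ?pi_neq0 ?(gauss_neq0 q1 primP). Qed.

Let coef1E j : sine_coef 1 j = tau * invchar j.
Proof.
rewrite /sine_coef (gsum1 q1 primP) /tau /invchar rmorphM /= invfM rmorph_nat; ring.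
Qed.

Let invcharM m n : invchar (m * n) = invchar m * invchar n.
Proof. by rewrite /invchar (chiM psiP) natrM !invfM; ring. Qed.

Let invchar1 : invchar 1 = 1.
Proof. by rewrite /invchar (chi1 psiP) invr1 mul1r. Qed.

Lemma normc_nat n : normc (n%:R : C) = n%:R.
Proof.
rewrite (_ : n%:R = (n%:R)%:C%C); last by rewrite rmorph_nat.
by rewrite normc_real ger0_norm.
Qed.

Lemma normc_psi n : normc (psi n) = if coprime n q then 1 else 0.
Proof.
case: ifPn => nq; first exact: (normc_chi psiP).
by rewrite (chi_eq0 psiP nq) ComplexField.Normc.normc0.
Qed.

Let invchar_le n : (0 < n)%N -> normc (invchar n) <= n%:R^-1.
Proof.
move=> n0; rewrite normcM !ComplexField.Normc.normcV normc_nat normc_psi.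
by case: ifP => _; rewrite ?invr1 ?mul1r // invr0 mul0r invr_ge0.
Qed.

Lemma l2span_coef1 : l2span (sine_coef 1) (@kronecker R).
Proof.
apply: l2span_trans (l2span_euler invcharM invchar1 invchar_le).
apply: eq_Cl (l2span_Z tau^-1 (l2span_refl _)) => n _.
by rewrite coef1E mulKf.
Qed.

(** The factor 2 is 1 for n = 1 plus at most 1 for the telescoped tail. The bound feeds the Neumann
    series. *)
Lemma coef1_bounded : exists K : R, forall N, sqnorm N (sine_coef 1) <= K.
Proof.
exists (normc tau ^+ 2 * 2) => N.
rewrite (eq_nrm _ (g := fun n => tau * invchar n)) => [|n _]; last exact: coef1E.
rewrite nrmZ ler_wpM2l ?sqr_ge0 //.
have E : forall n, (0 < n)%N -> normc (invchar n) ^+ 2 <= (n%:R ^- 1) ^+ 2.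
  by move=> n n0; rewrite ler_sqr ?nnegrE ?normc_ge0 ?invr_ge0 // invchar_le.
case: N => [|N]; first by rewrite /sqnorm big_nil.
rewrite /sqnorm big_ltn // (_ : 2 = 1 + 1 :> R) // lerD //.
  by rewrite invchar1 ComplexField.Normc.normc1 expr1n.
apply: le_trans (_ : _ <= \sum_(2 <= n < N.+2) (n%:R ^- 1) ^+ 2) _.
  rewrite [X in X <= _]big_nat [X in _ <= X]big_nat; apply: ler_sum => n /andP[n2 _].
  by apply: E; apply: ltnW.
have := @sum_inv_sqr R 2 N.+1 isT; rewrite big_ltn //= add0r invr1.
apply: le_trans; rewrite [X in X <= _]big_nat [X in _ <= X]big_nat.
by apply: ler_sum => n /andP[n2 _]; rewrite n2.
Qed.

(** The factor p in [gsum_mulp] is absorbed by p/j = 1/(j/p), which leaves a pure dilation. *)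
Lemma coef_mulp p n j : prime p -> (0 < n)%N -> (0 < j)%N ->
  sine_coef (p * n) j = dilate p (sine_coef n) j - (if (p %| n)%N then 0 else psi p * sine_coef n j).
Proof.
move=> pp n0 j0; rewrite /sine_coef (gsum_mulp q1 primP) // mulrBl /dilate.
congr (_ - _); last by case: ifP; rewrite ?mul0r // mulrA.
case: ifPn => [/dvdnP[k jE]|_]; last by rewrite mul0r.
have p0 := prime_gt0 pp; have k0 : (0 < k)%N by move: j0; rewrite jE; case: (k).
have := realC_neq0 pi_neq0.
rewrite jE mulnK // natrM !rmorphM /= !rmorph_nat; move: (_%:C)%C => P P0; field.
by rewrite P0 !pnatr_eq0 -!lt0n p0 k0.
Qed.

(** Applying D_p - psi(p) to an approximation of [kronecker] from S_n approximates the image of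
    [kronecker] from S_(pn); the ergodic lemma then recovers [kronecker] from that image. *)
Lemma l2span_coef_squarefree (s : seq nat) : uniq s -> all prime s ->
  coprime (\prod_(p <- s) p)%N q -> l2span (sine_coef (\prod_(p <- s) p)%N) (@kronecker R).
Proof.
elim: s => [|p s IH]; first by rewrite big_nil => _ _ _; apply: l2span_coef1.
rewrite big_cons /= => /andP[ps us] /andP[pp sp]; rewrite coprimeMl => /andP[pq sq].
set n := (\prod_(p <- s) p)%N in sq *.
have n0 : (0 < n)%N.
  rewrite /n big_seq; apply: prodn_cond_gt0 => r rs.
  by apply: prime_gt0; apply: (allP sp).
have pn : ~~ (p %| n)%N.
  rewrite /n; apply: contra ps; elim: (s) sp => [|r t IHt].
    by rewrite big_nil dvdn1 => _ /eqP p1; rewrite p1 in pp.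
  move=> /= /andP[rp tp]; rewrite big_cons Euclid_dvdM // inE.
  by case/orP => [|/(IHt tp) ->]; rewrite ?orbT // dvdn_prime2 // => ->.
have p0 := prime_gt0 pp.
pose t := [:: (p, 1); (1%N, - psi p)].
have t0 : posidx t by rewrite /posidx /= p0.
have tE f j : dilcomb t f j = dilate p f j - psi p * f j.
  by rewrite /dilcomb big_cons big_seq1 /= dil1 mul1r mulNr.
have h := l2span_image t0 (IH us sp sq).
apply: l2span_trans; first apply: eq_Cll h => j j0.
  by rewrite tE coef_mulp // (negPf pn).
apply: eq_Cll (l2span_shift_minus pp (c := psi p) _) => [j j0|]; first by rewrite tE.
by rewrite normc_psi pq.
Qed.

(** A new prime p adds a second copy of s of weight |psi(p)|: the total doubles if p is prime to q
    and is unchanged if p divides q. A repeated prime only dilates. *)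
Lemma coef_dcomb n : (0 < n)%N -> exists s, [/\ posidx s, weight s <= (squarefree_weight q n)%:R &
  forall j, (0 < j)%N -> sine_coef n j = dilcomb s (sine_coef 1) j].
Proof.
move: n; apply: prime_ind => [|p n pp n0 [s [s0 ws sE]]].
  exists [:: (1%N, 1)]; split => // [|j j0].
    by rewrite /weight big_seq1 aw1 [X in X <= _]ComplexField.Normc.normc1.
  by rewrite /dilcomb big_seq1 dil1 mul1r.
have p0 := prime_gt0 pp.
exists (dil_comb p s ++ (if (p %| n)%N then [::] else scal_comb (- psi p) s)); split.
- by rewrite pos_cat pos_dil //; case: ifP => // _; rewrite pos_scal.
- rewrite wt_cat wt_dil aw_mulp // natrM; case: ifPn => pn /=.
    by rewrite {2}/weight big_nil addr0 mulr1.
  rewrite wt_scal normcN normc_psi; case: ifP => _ /=; first by lra.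
  by rewrite mul0r addr0 mulr1.
- move=> j j0; rewrite dcomb_cat dcomb_dil // coef_mulp //; congr (_ + _).
    exact: eq_dil.
  case: ifP => _; first by rewrite oppr0 /dilcomb big_nil.
  by rewrite dcomb_scal sE // mulNr.
Qed.

Lemma l2span_coef_sum (u : nat) (c : nat -> C) : (0 < u)%N ->
  ((ndiv (u * coprime_part u q))%:R - 1) *
    \big[Num.max/0]_(d <- divisors u | (1 < d)%N) normc (c d) < normc (c 1%N) ->
  l2span (fun j => \sum_(d <- divisors u) c d * sine_coef d j) (@kronecker R).
Proof.
(* Since a(1) = 1, the constant d(uu') - 1 is the sum of a(d) over the divisors d > 1. *)
move=> u0; rewrite -(sum_aw q0 u0) (big_rem 1%N) ?divisor1 //= aw1 natrD (addrC 1) addrK.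
set M := \big[Num.max/0]_(_ <- _ | _) _ => hc.
have M0 : 0 <= M by apply: bigmax_ge_id.
have c1 : 0 < normc (c 1%N) by apply: le_lt_trans hc; rewrite mulr_ge0.
have c1' : c 1%N != 0.
  by apply/eqP => c10; move: c1; rewrite c10 ComplexField.Normc.normc0 ltxx.
have /choice[sd sdP] : forall n, exists s, (0 < n)%N -> [/\ posidx s, weight s <= (squarefree_weight q n)%:R &
  forall j, (0 < j)%N -> sine_coef n j = dilcomb s (sine_coef 1) j].
  move=> n; have [->|n0] := posnP n; first by exists [::].
  by have [s sP] := coef_dcomb n0; exists s.
pose r := rem 1%N (divisors u).
(* The perturbation: the sum of (c_d / c_1) A_d over d > 1, each A_d being the combination that
   yields S_d from S_1. *)
pose s := flatten [seq scal_comb (c d / c 1%N) (sd d) | d <- r].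
have r0 d : d \in r -> [/\ (0 < d)%N, (1 < d)%N & d \in divisors u].
  move=> dr; have du := mem_rem dr; have d0 : (0 < d)%N.
    by move: du; rewrite -dvdn_divisors // => du; apply: dvdn_gt0 du.
  split=> //; rewrite ltn_neqAle d0 andbT eq_sym; apply: contraTneq dr => ->.
  by rewrite mem_rem_uniqF ?divisors_uniq.
have s0 : posidx s.
  apply/allP => e /flattenP[t /mapP[d dr ->]].
  have [d0 _ _] := r0 d dr; have [+ _ _] := sdP d d0.
  by rewrite -(pos_scal (c d / c 1%N)) => /allP; apply.
have ws : weight s < 1.
  rewrite /weight big_flatten /= big_map -(ltr_pM2l c1) mulr1; apply: le_lt_trans hc.
  rewrite natr_sum mulr_sumr mulr_suml -/r big_seq [X in _ <= X]big_seq.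
  apply: ler_sum => d dr; have [d0 d1 du] := r0 d dr; have [_ wd _] := sdP d d0.
  rewrite -/(weight _) wt_scal normcM ComplexField.Normc.normcV mulrA mulrCA mulfV ?gt_eqF // mulr1 mulrC.
  apply: ler_pM => //; rewrite ?wt_ge0 ?normc_ge0 //.
  by have := @le_bigmax_seq _ _ _ _ (0 : R) d (fun i => 1 < i)%N (fun i => normc (c i)) du d1.
have [K hK] := coef1_bounded.
have h := l2span_neumann s0 ws hK.
apply: l2span_trans l2span_coef1; apply: l2span_trans h.
apply: eq_Cl (l2span_Z (c 1%N)^-1 (l2span_refl _)) => j j0.
rewrite (big_rem 1%N) ?divisor1 //= mulrDr mulKf // -/r; congr (_ + _).
rewrite mulr_sumr /dilcomb big_flatten /= big_map big_seq [RHS]big_seq.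
apply: eq_bigr => d dr; have [d0 _ _] := r0 d dr; have [_ _ sE] := sdP d d0.
by rewrite -/(dilcomb _ _ _) dcomb_scal sE //; ring.
Qed.

End Coefficients.

(** * The sawtooth series *)

Section Sawtooth.
Variable R : realType.
Implicit Types (x y t a : R) (j k n N : nat).

Lemma is_derive_sinM c t : is_derive t (1 : R) (fun s => sin (c * s)) (c * cos (c * t)).
Proof.
have h : is_derive t (1 : R) (fun s => c * s) c.
  by apply: (is_derive_eq (is_deriveZ c (is_derive_id t 1))); rewrite scaler1.
apply: (is_derive_eq (is_derive1_comp (is_derive_sin (c * t)) h)).
by rewrite mulrC.
Qed.

Lemma is_derive_cosM c t : is_derive t (1 : R) (fun s => cos (c * s)) (- c * sin (c * t)).
Proof.
have h : is_derive t (1 : R) (fun s => c * s) c.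
  by apply: (is_derive_eq (is_deriveZ c (is_derive_id t 1))); rewrite scaler1.
apply: (is_derive_eq (is_derive1_comp (is_derive_cos (c * t)) h)).
by rewrite mulrC mulrN mulNr.
Qed.

Definition sinsum N t : R := \sum_(1 <= j < N.+1) sin (j%:R * t) / j%:R.

Lemma is_derive_sinsum N t :
  is_derive t (1 : R) (sinsum N) (\sum_(1 <= j < N.+1) cos (j%:R * t)).
Proof.
elim: N => [|N IH].
  rewrite (_ : sinsum 0 = cst 0); last by apply/funext => s; rewrite /sinsum big_nil.
  by rewrite big_nil; apply: is_derive_cst.
rewrite (_ : sinsum N.+1 = sinsum N + (N.+1%:R^-1 *: (fun s => sin (N.+1%:R * s)))).
  apply: (is_derive_eq (is_deriveD IH (is_deriveZ N.+1%:R^-1 (is_derive_sinM N.+1%:R t)))).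
  rewrite [RHS]big_nat_recr //=; congr (_ + _).
  by rewrite /GRing.scale /= mulrA mulVf ?mul1r // pnatr_eq0.
apply/funext => s; rewrite /sinsum big_nat_recr //= !fctE.
by rewrite /GRing.scale /= (mulrC (_^-1)).
Qed.

Lemma dirichlet_kernel N t :
  2 * sin (t / 2) * (2^-1 + \sum_(1 <= j < N.+1) cos (j%:R * t)) = sin ((N%:R + 2^-1) * t).
Proof.
elim: N => [|N IH].
  by rewrite big_nil addr0 mulrAC divff ?mul1r ?add0r 1?mulrC // pnatr_eq0.
rewrite big_nat_recr //= addrA mulrDr IH.
have e1 : (N%:R + 2^-1) * t = N.+1%:R * t - t / 2 by rewrite -natr1; field.
have e2 : (N.+1%:R + 2^-1) * t = N.+1%:R * t + t / 2 by field.
rewrite e1 e2 !sinD sinN cosN; ring.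
Qed.

Lemma nonincr_at (f df : R -> R) a b : a <= b ->
  (forall x, a <= x <= b -> is_derive x (1 : R) f (df x)) ->
  (forall x, a <= x <= b -> df x <= 0) -> f b <= f a.
Proof.
move=> ab fd df0.
have [||c cab E] := @MVT_segment R f df a b ab.
- by move=> x; rewrite in_itv /= => /andP[ax xb]; apply: fd; rewrite !ltW.
- apply: derivable_within_continuous => x; rewrite in_itv /= => xab.
  exact: (@ex_derive _ _ _ _ _ _ _ (fd x xab)).
rewrite -subr_le0 E; rewrite in_itv /= in cab.
by rewrite mulr_le0_ge0 ?df0 // subr_ge0.
Qed.

(* For the error [E] of the N-th partial sum, integrating the Dirichlet kernel by
   parts shows that both [(1 + e cos ((N + 1/2) t)) / ((2N+1) sin (t/2)) + e E t],
   e = 1 or -1, are nonincreasing on (0, pi]; they are nonnegative at pi. *)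
Lemma sinsum_error N t : 0 < t <= pi ->
  `|sinsum N t - (pi - t) / 2| <= 2 / ((2 * N%:R + 1) * sin (t / 2)).
Proof.
move=> /andP[t0 tpi].
pose K : R := 2 * N%:R + 1; pose w : R := N%:R + 2^-1.
have K0 : 0 < K by rewrite ltr_wpDl // mulr_ge0.
have sin0 x : t <= x <= pi -> 0 < sin (2^-1 * x).
  move=> /andP[tx xpi]; apply: sin_gt0_pi.
  by apply/andP; split; have := pi_gt0 R; lra.
have cos0 x : t <= x <= pi -> 0 <= cos (2^-1 * x).
  by move=> /andP[tx xpi]; apply: cos_ge0_pihalf; apply/andP; split; lra.
pose f e x := (1 + e * cos (w * x)) / (K * sin (2^-1 * x)) + e * (sinsum N x - (pi - x) / 2).
pose df e x := - (1 + e * cos (w * x)) * cos (2^-1 * x) / (2 * K * sin (2^-1 * x) ^+ 2).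
have fd e x : t <= x <= pi -> is_derive x (1 : R) (f e) (df e x).
  move=> xI; have s0 := sin0 x xI.
  have dsin := is_derive_sinM 2^-1 x; have dcos := is_derive_cosM w x.
  have dS := is_derive_sinsum N x.
  have d1 : is_derive x (1 : R) (fun s => 1 + e * cos (w * s)) (e * (- w * sin (w * x))).
    apply: (is_derive_eq (is_deriveD (is_derive_cst (1 : R) x 1) (is_deriveZ e dcos))).
    by rewrite add0r.
  have d2 : is_derive x (1 : R) (fun s => (K * sin (2^-1 * s))^-1)
      (- (K * sin (2^-1 * x)) ^- 2 * (K * (2^-1 * cos (2^-1 * x)))).
    apply: (is_derive_eq (is_deriveV _ (is_deriveZ K dsin))) => //.
    by rewrite mulf_neq0 ?gt_eqF.
  have d3 : is_derive x (1 : R) (fun s => e * (sinsum N s - (pi - s) / 2))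
      (e * (\sum_(1 <= j < N.+1) cos (j%:R * x) + 2^-1)).
    have d4 : is_derive x (1 : R) (fun s => (pi - s) / 2) (- 2^-1).
      rewrite (_ : (fun s => _) = 2^-1 *: (cst pi - id)); last first.
        by apply/funext => s; rewrite /GRing.scale /= !fctE mulrC.
      apply: (is_derive_eq (is_deriveZ 2^-1 (is_deriveB (is_derive_cst (pi : R) x 1) (is_derive_id x 1)))).
      by rewrite /GRing.scale /= sub0r mulrN1.
    apply: (is_derive_eq (is_deriveZ e (is_deriveB dS d4))).
    by rewrite opprK.
  apply: (is_derive_eq (is_deriveD (is_deriveM d1 d2) d3)).
  rewrite /GRing.scale /= /df.
  have dk := dirichlet_kernel N x.
  have -> : \sum_(1 <= j < N.+1) cos (j%:R * x) + 2^-1 = sin (w * x) / (2 * sin (2^-1 * x)).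
    rewrite /w -dk (mulrC x) addrC; field; by rewrite gt_eqF.
  have wK : w = K / 2 by rewrite /w /K; field.
  move: (sin (w * x)) (cos (w * x)) (sin (2^-1 * x)) (cos (2^-1 * x)) s0 => A B S D S0.
  by rewrite wK; field; rewrite !gt_eqF.
have df0 e x : `|e| <= 1 -> t <= x <= pi -> df e x <= 0.
  move=> e1 xI; rewrite /df mulNr mulNr oppr_le0 divr_ge0 //.
    rewrite mulr_ge0 ?cos0 //.
    have := ler_norm (- (e * cos (w * x))); rewrite normrN normrM.
    have : `|cos (w * x)| <= 1 by rewrite ler_norml cos_geN1 cos_le1.
    by move: (normr_ge0 e) (normr_ge0 (cos (w * x))) e1; nra.
  by rewrite mulr_ge0 ?sqr_ge0 // mulr_ge0 // ltW.
have f0 e : `|e| <= 1 -> 0 <= f e t.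
  move=> e1; apply: le_trans _ (nonincr_at tpi (fd e) (fun x => df0 e x e1)).
  (* At pi both the partial sum and (pi - x)/2 vanish, so only the nonnegative quotient is left. *)
  rewrite /f subrr mul0r subr0 (_ : sinsum N pi = 0).
    rewrite mulr0 addr0 divr_ge0 //.
      have := ler_norm (- (e * cos (w * pi))); rewrite normrN normrM.
      have : `|cos (w * pi)| <= 1 by rewrite ler_norml cos_geN1 cos_le1.
      by move: (normr_ge0 e) (normr_ge0 (cos (w * pi))) e1; nra.
    by rewrite mulr_ge0 ?ltW // sin0 // tpi lexx.
  rewrite /sinsum big1 // => j _; rewrite (_ : sin _ = 0) ?mul0r //.
  elim: j => [|j IH]; first by rewrite mul0r trigo.sin0.
  by rewrite -natr1 mulrDl mul1r sinDpi IH oppr0.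
have tI : t <= t <= pi by rewrite lexx.
have s0 := sin0 t tI.
(* The two signs bound the error from below and from above; 1 + cos and 1 - cos are at most 2,
   whence the numerator 2. *)
have h1 := f0 1; have h2 := f0 (-1).
rewrite normr1 lexx in h1; rewrite normrN normr1 lexx in h2.
move: (h1 isT) (h2 isT); rewrite /f (mulrC t) => {}h1 {}h2.
set E := sinsum N t - _ in h1 h2 *.
have Q0 : 0 < (K * sin (2^-1 * t))^-1 by rewrite invr_gt0 mulr_gt0.
rewrite -/K; move: (K * sin _)^-1 Q0 h1 h2 => Q Q0.
have := cos_geN1 (w * t); have := cos_le1 (w * t); move: (cos _) => c c1 c2 h1 h2.
by rewrite ler_norml; apply/andP; split; nra.
Qed.

End Sawtooth.

(** * Periodic sawtooth and indicators of intervals *)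

Section PeriodicSawtooth.
Variable R : realType.
Implicit Types (x y t a f : R) (j k n N : nat) (z : int).

(** The representative in [0, 2) used inside [odd_ext]. *)
Definition frac2 y : R := y - 2 * (Num.floor (y / 2))%:~R.

Lemma frac2E y : exists z, y = frac2 y + 2 * z%:~R.
Proof. by exists (Num.floor (y / 2)); rewrite /frac2 subrK. Qed.

Lemma frac2_itv y : 0 <= frac2 y < 2.
Proof.
have := floor_itv (y / 2); rewrite /frac2 intrD1.
move: (_%:~R) => z /andP[h1 h2]; apply/andP; split; lra.
Qed.

Lemma frac2_eq f z y : 0 <= f < 2 -> y = f + 2 * z%:~R -> frac2 y = f.
Proof.
move=> /andP[f0 f2] yE; rewrite /frac2 (_ : Num.floor (y / 2) = z).
  by rewrite yE addrK.
apply: floor_def; rewrite intrD1 yE.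
by apply/andP; split; lra.
Qed.

Lemma sin_2piz x z : sin (x + 2 * pi * z%:~R) = sin x.
Proof.
have nat_case k (u : R) : sin (u + 2 * pi * k%:R) = sin u.
  rewrite -(periodicn (@sinD2pi R) k u); congr (sin (u + _)).
  by ring.
case: z => k; first by rewrite -pmulrn nat_case.
rewrite NegzE rmorphN /= -[in RHS](subrK (2 * pi * k.+1%:R) x).
by rewrite nat_case mulrN.
Qed.

Definition saw_partial N y : R := sinsum N (pi * y).

(** The sum of the sine series away from even integers; there the series gives 0 but this formula pi
    / 2, which is why [0 < frac2 y] is assumed below. *)
Definition saw y : R := (pi - pi * frac2 y) / 2.

Lemma spart_frac2 N y : saw_partial N y = saw_partial N (frac2 y).
Proof.
have [z yE] := frac2E y; rewrite /saw_partial /sinsum; apply: eq_bigr => j _.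
congr (_ / _); rewrite {1}yE -[RHS](sin_2piz _ (j%:Z * z)); congr sin.
by rewrite intrM -pmulrn; ring.
Qed.

Lemma sinsum_refl N t : sinsum N (2 * pi - t) = - sinsum N t.
Proof.
rewrite /sinsum -sumrN; apply: eq_bigr => j _; rewrite -mulNr; congr (_ / _).
rewrite -sinN -[RHS](sin_2piz _ j%:Z); congr sin; rewrite -pmulrn; ring.
Qed.

Lemma sinsum_error2 N t : 0 < t < 2 * pi ->
  `|sinsum N t - (pi - t) / 2| <= 2 / ((2 * N%:R + 1) * sin (t / 2)).
Proof.
move=> /andP[t0 t2]; have [tpi|tpi] := leP t pi.
  by apply: sinsum_error; rewrite t0.
have := @sinsum_error R N (2 * pi - t); rewrite sinsum_refl.
rewrite (_ : (pi - (2 * pi - t)) / 2 = - ((pi - t) / 2)); last by field.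
rewrite -opprD normrN (_ : (2 * pi - t) / 2 = pi - t / 2); last by field.
rewrite (_ : sin (pi - t / 2) = sin (t / 2)).
  by apply; apply/andP; split; lra.
by rewrite addrC sinDpi sinN opprK.
Qed.

Lemma normr_sin_natM k x : `|sin (k%:R * x)| <= k%:R * `|sin x|.
Proof.
elim: k => [|k IH]; first by rewrite !mul0r sin0 normr0.
rewrite -natr1 mulrDl mul1r sinD mulrDl mul1r.
apply: le_trans (ler_normD _ _) _; rewrite !normrM lerD //.
  apply: le_trans IH; rewrite ler_piMr //.
  by rewrite ler_norml cos_geN1 cos_le1.
by rewrite ler_piMl // ler_norml cos_geN1 cos_le1.
Qed.

Lemma sinsum_le N t : `|sinsum N t| <= 2 * N%:R * `|sin (t / 2)|.
Proof.
apply: le_trans (ler_norm_sum _ _ _) _.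
apply: (@le_trans _ _ (\sum_(1 <= j < N.+1) 2 * `|sin (t / 2)|)).
  rewrite big_nat [X in _ <= X]big_nat; apply: ler_sum => j /andP[j1 _].
  have j0 : 0 < j%:R :> R by rewrite ltr0n.
  rewrite normrM normfV (ger0_norm (ltW j0)) ler_pdivrMr //.
  have := normr_sin_natM (2 * j) (t / 2); rewrite natrM.
  rewrite (_ : 2%:R * j%:R * (t / 2) = j%:R * t); last by field.
  by rewrite mulrAC.
by rewrite sumr_const_nat subn1 -[_ *+ _]mulr_natr mulrAC.
Qed.

(** A bound free of N and y, to serve as dominating constant. If N sin(t/2) <= 1, termwise estimates
    bound the partial sum by 2 and the limit by pi; otherwise the kernel estimate is already below
    2. *)
Lemma spart_error_le N y : 0 < frac2 y -> `|saw_partial N y - saw y| <= 2 + pi.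
Proof.
move=> f0; have /andP[_ f2] := frac2_itv y; rewrite spart_frac2 /saw /saw_partial.
move: (frac2 y) f0 f2 => f f0 f2; have p0 := pi_gt0 R.
set t := pi * f; have t0 : 0 < t by rewrite mulr_gt0.
have t2 : t < 2 * pi by rewrite /t mulrC ltr_pM2r.
have s0 : 0 < sin (t / 2) by apply: sin_gt0_pi; apply/andP; split; lra.
have [Ns|Ns] := leP (N%:R * sin (t / 2)) 1.
  apply: le_trans (ler_normB _ _) _; apply: lerD.
    by apply: le_trans (sinsum_le _ _) _; rewrite (gtr0_norm s0) -mulrA; lra.
  by rewrite ler_norml; apply/andP; split; lra.
apply: le_trans (_ : 2 <= _); last by rewrite lerDl ltW.
apply: le_trans (sinsum_error2 _ _) _; first by rewrite t0.
have N0 : 0 <= N%:R :> R by [].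
by rewrite ler_pdivrMr; [nra | rewrite mulr_gt0 // ltr_wpDl // mulr_ge0].
Qed.

Lemma spart_cvg y : 0 < frac2 y -> (saw_partial^~ y @ \oo --> saw y)%classic.
Proof.
move=> f0; have /andP[_ f2] := frac2_itv y.
have p0 := pi_gt0 R.
pose t := pi * frac2 y; have t0 : 0 < t by rewrite mulr_gt0.
have t2 : t < 2 * pi by rewrite /t mulrC ltr_pM2r.
have s0 : 0 < sin (t / 2) by apply: sin_gt0_pi; apply/andP; split; lra.
apply/cvgrPdist_le => e e0.
exists (Num.truncn (2 / (e * sin (t / 2)))).+1 => // N /= hN.
rewrite spart_frac2 /saw /saw_partial -/t distrC.
apply: le_trans (sinsum_error2 _ _) _; first by rewrite t0.
have : 2 / (e * sin (t / 2)) < N%:R.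
  by apply: lt_le_trans (truncnS_gt _) _; rewrite ler_nat.
rewrite ltr_pdivrMr ?mulr_gt0 // => h.
rewrite ler_pdivrMr; last by rewrite mulr_gt0 // ltr_wpDl // mulr_ge0.
have N0 : 0 <= N%:R :> R by [].
have : 0 <= e * sin (t / 2) by rewrite ltW // mulr_gt0.
have : 0 <= N%:R * (e * sin (t / 2)) by rewrite mulr_ge0 // ltW // mulr_gt0.
rewrite mulrCA [e * _]mulrC; nra.
Qed.

Definition step_fun a x : R[i] := if (a < x) && (x < 1) then 1 else 0.

(** [saw] has slope -pi/2 and jumps up by pi at even integers. The odd extension of the indicator of
    (a, 1) jumps by 1 at a and -a and by -2 at 1, and the three slopes cancel. *)
Definition step_saw a y : R := (saw (y + a) + saw (y - a) - 2 * saw (y + 1)) / pi.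

Lemma odd_ext_stepf a y : 0 <= a < 1 ->
  0 < frac2 y -> 0 < frac2 (y + 1) -> 0 < frac2 (y - a) -> 0 < frac2 (y + a) ->
  odd_ext (step_fun a) y = ((step_saw a y)%:C)%C.
Proof.
move=> /andP[a0 a1]; have /andP[_] := frac2_itv y; rewrite /odd_ext -/(frac2 y) /step_saw /saw.
have p0 : pi != 0 :> R by rewrite gt_eqF // pi_gt0.
have [z yE] := frac2E y; move: (frac2 y) yE => f yE f2 f0; move: (pi : R) p0 => P p0.
have m1 g : y - a = g + 2 * z%:~R -> y - a = (g + 2) + 2 * (z - 1)%:~R by rewrite intrB => ->; ring.
have [f1|f1|f1] := ltgtP f 1.
- have -> : frac2 (y + 1) = f + 1.
    by apply: (@frac2_eq _ z); [apply/andP; split; lra | rewrite yE; ring].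
  have -> : frac2 (y + a) = f + a.
    by apply: (@frac2_eq _ z); [apply/andP; split; lra | rewrite yE; ring].
  move=> _; rewrite f0 /= /step_fun f1 andbT; case: (ltgtP a f) => [af|fa|->].
  + rewrite (@frac2_eq (f - a) z) //; [|by apply/andP; split; lra|by rewrite yE; ring].
    by move=> _ _; apply: (congr1 (fun x : R => x%:C)%C); field.
  + rewrite (@frac2_eq (f - a + 2) (z - 1)) //; [|by apply/andP; split; lra|by rewrite yE intrB; ring].
    by move=> _ _; apply: (congr1 (fun x : R => x%:C)%C); field.
  + rewrite (@frac2_eq 0 z (y - f)); [by rewrite ltxx|by apply/andP; split; lra|by rewrite yE; ring].
- have -> : frac2 (y + 1) = f - 1.
    by apply: (@frac2_eq _ (z + 1)); [apply/andP; split; lra | rewrite yE intrD; ring].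
  have -> : frac2 (y - a) = f - a.
    by apply: (@frac2_eq _ z); [apply/andP; split; lra | rewrite yE; ring].
  move=> _ _; rewrite f0 f2 /=.
  rewrite /step_fun (_ : 2 - f < 1) ?andbT; last by lra.
  case: (ltgtP a (2 - f)) => [af|fa|af].
  + rewrite (@frac2_eq (f + a) z) //; [|by apply/andP; split; lra|by rewrite yE; ring].
    by move=> _; rewrite -[1 in LHS](rmorph1 (real_complex R)) -rmorphN; congr (_%:C)%C; field.
  + rewrite (@frac2_eq (f + a - 2) (z + 1)) //; [|by apply/andP; split; lra|by rewrite yE intrD; ring].
    by move=> _; rewrite oppr0; apply: (congr1 (fun x : R => x%:C)%C); field.
  + rewrite (@frac2_eq 0 (z + 1) (y + a)); [by rewrite ltxx|by apply/andP; split; lra|by rewrite yE intrD; lra].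
- rewrite (@frac2_eq 0 (z + 1) (y + 1)); [by rewrite ltxx|by apply/andP; split; lra|by rewrite yE f1 intrD; ring].
Qed.

Definition step_partial a N y : R := (saw_partial N (y + a) + saw_partial N (y - a) - 2 * saw_partial N (y + 1)) / pi.

Lemma steppartE a N y :
  step_partial a N y = \sum_(1 <= j < N.+1)
    2 / (pi * j%:R) * (cos (pi * j%:R * a) - cos (pi * j%:R)) * sin (pi * j%:R * y).
Proof.
rewrite /step_partial /saw_partial /sinsum mulr_sumr -big_split /= -sumrB mulr_suml.
apply: eq_big_nat => j /andP[j1 _].
have j0 : j%:R != 0 :> R by rewrite pnatr_eq0 -lt0n.
have p0 : pi != 0 :> R by rewrite gt_eqF // pi_gt0.
have sj : sin (pi * j%:R) = 0 :> R.
  move: j {j1 j0}; elim => [|k IH]; first by rewrite mulr0 sin0.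
  by rewrite -natr1 mulrDr mulr1 sinDpi IH oppr0.
have -> : j%:R * (pi * (y + a)) = pi * j%:R * y + pi * j%:R * a by ring.
have -> : j%:R * (pi * (y - a)) = pi * j%:R * y - pi * j%:R * a by ring.
have -> : j%:R * (pi * (y + 1)) = pi * j%:R * y + pi * j%:R by ring.
rewrite !sinD cosN sinN sj; move: (pi : R) p0 => P p0; field; by rewrite j0 p0.
Qed.

Lemma steppart_error_le a y N : 0 < frac2 (y + 1) -> 0 < frac2 (y - a) -> 0 < frac2 (y + a) ->
  `|step_saw a y - step_partial a N y| <= 4 * (2 + pi) / pi.
Proof.
move=> h1 h2 h3; rewrite /step_saw /step_partial -mulrBl normrM.
have p0 := pi_gt0 R.
rewrite [X in _ * X]gtr0_norm ?invr_gt0 // ler_pM2r ?invr_gt0 //.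
have := spart_error_le N h1; have := spart_error_le N h2; have := spart_error_le N h3.
rewrite !ler_norml => /andP[? ?] /andP[? ?] /andP[? ?].
by apply/andP; split; lra.
Qed.

Lemma steppart_cvg a y : 0 < frac2 (y + 1) -> 0 < frac2 (y - a) -> 0 < frac2 (y + a) ->
  ((fun N => step_partial a N y) @ \oo --> step_saw a y)%classic.
Proof.
move=> h1 h2 h3; apply: cvgMl; apply: cvgB; first by apply: cvgD; apply: spart_cvg.
by apply: cvgMr; apply: spart_cvg.
Qed.

End PeriodicSawtooth.

(** * Square integrals on (0,1) *)

Section SquareIntegrals.
Local Open Scope classical_set_scope.
Variable R : realType.
Local Notation C := R[i].
Local Notation mu := (@lebesgue_measure R).
Implicit Types (f g : R -> C) (x : R).

Definition I01 : set R := `]0%R, 1%R[.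

Lemma mI01 : measurable I01. Proof. exact: measurable_itv. Qed.
Hint Resolve mI01 : core.

Lemma muI01 : mu I01 = 1%E.
Proof. by rewrite /I01 lebesgue_measure_itv /= lte_fin ltr01 oppr0 adde0. Qed.

Lemma I01E x : I01 x = (0 < x < 1).
Proof. by rewrite /I01 /= in_itv. Qed.

Lemma ae_imp (P Q : R -> Prop) : (forall x, P x -> Q x) ->
  {ae mu, forall x, P x} -> {ae mu, forall x, Q x}.
Proof.
move=> PQ; apply: (@filterS _ _ (ae_filter_ringOfSetsType mu)) => x; exact: PQ.
Qed.

Lemma ae_conj (P Q : R -> Prop) : {ae mu, forall x, P x} -> {ae mu, forall x, Q x} ->
  {ae mu, forall x, P x /\ Q x}.
Proof. by move=> aP aQ; apply: (@filterI _ _ (ae_filter_ringOfSetsType mu)). Qed.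

Lemma integrable_bounded (G : R -> R) (B : R) : measurable_fun I01 G ->
  (forall x, I01 x -> `|G x| <= B) -> mu.-integrable I01 (EFin \o G).
Proof.
move=> mG GB; apply: measurable_bounded_integrable => //; first by rewrite [X in (X < _)%E]muI01 ltry.
by exists B; split; [exact: num_real|] => M BM x Ix; apply: le_trans (GB x Ix) (ltW BM).
Qed.

Lemma dominated_small (u : nat -> R -> R) (G : R -> R) :
  (forall N, measurable_fun I01 (u N)) -> mu.-integrable I01 (EFin \o G) ->
  {ae mu, forall x, I01 x -> (forall N, u N x ^+ 2 <= G x) /\ (u ^~ x @ \oo --> (0 : R))} ->
  forall eps : R, 0 < eps -> exists N0, forall N, (N0 <= N)%N ->
    (\int[mu]_(x in I01) (u N x ^+ 2)%:E <= eps%:E)%E.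
Proof.
move=> mu_ iG uG eps e0.
have mu2 N : measurable_fun I01 (EFin \o (fun x => u N x ^+ 2)).
  by apply/measurable_EFinP; apply: measurable_funX.
have [|||_ _ cv] := @dominated_convergence _ _ R mu I01 mI01 (fun N (x : R) => (u N x ^+ 2)%:E) (cst 0%E) (EFin \o G) mu2 _ _ iG.
- exact: measurable_cst.
- apply: ae_imp uG => x h Ix; have [_ ux] := h Ix.
  apply: cvg_EFin; first by apply: nearW.
  have h2 := cvgM ux ux; rewrite mulr0 in h2.
  suff -> : (fine \o (fun x0 : nat => (u x0 x ^+ 2)%:E)) = (u^~ x \* u^~ x) by exact: h2.
  by apply/funext => N /=; rewrite expr2.
- apply: ae_imp uG => x h N Ix; have [uN _] := h Ix.
  by rewrite /= lee_fin ger0_norm ?sqr_ge0.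
move: cv; rewrite integral0 => /fine_cvgP[[N1 _ h1]] /cvgrPdist_le /(_ _ e0) [N2 _ h2].
exists (maxn N1 N2) => N; rewrite geq_max => /andP[/h1 /= h1N /h2 /=].
rewrite sub0r normrN => h2N; rewrite -(fineK h1N) lee_fin.
exact: le_trans (ler_norm _) h2N.
Qed.

(** The exceptional x solve kx + c = 2z with z an integer: countably many. *)
Lemma ae_frac2 (k c : R) : k != 0 -> {ae mu, forall x, 0 < frac2 (k * x + c)}.
Proof.
move=> k0; pose A := range (fun z : int => (2 * z%:~R - c) / k).
have cA : countable A by apply: (sub_countable (card_image_le _ _)); apply: countableP.
exists A; split.
- by apply: countable_measurable => // x; apply: measurable_set1.
- exact: countable_lebesgue_measure0.
- move=> x /= /negP; have /andP[f0 _] := frac2_itv (k * x + c).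
  rewrite lt_neqAle f0 andbT negbK => /eqP f2; have [z zE] := frac2E (k * x + c).
  exists z => //; rewrite -f2 add0r in zE; rewrite -zE addrK mulrAC divff ?mul1r //.
Qed.

End SquareIntegrals.

(** * L2-convergent sine expansions *)

Section SineExpansions.
Local Open Scope classical_set_scope.
Variable R : realType.
Local Notation C := R[i].
Local Notation mu := (@lebesgue_measure R).
Local Notation I01 := (@I01 R).
Implicit Types (f g phi : R -> C) (x a : R).
Hint Extern 0 (measurable _) => solve [exact: mI01] : core.

Definition measC f := measurable_fun I01 (fun x => complex.Re (f x)) /\
  measurable_fun I01 (fun x => complex.Im (f x)).

Definition sqnormI f : \bar R := (\int[mu]_(x in I01) ((normc (f x)) ^+ 2)%:E)%E.

Lemma complexReD (z w : C) : complex.Re (z + w) = complex.Re z + complex.Re w.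
Proof. by case: z w => ? ? []. Qed.
Lemma complexImD (z w : C) : complex.Im (z + w) = complex.Im z + complex.Im w.
Proof. by case: z w => ? ? []. Qed.
Lemma complexReM (z w : C) : complex.Re (z * w) =
  complex.Re z * complex.Re w - complex.Im z * complex.Im w.
Proof. by case: z w => ? ? []. Qed.
Lemma complexImM (z w : C) : complex.Im (z * w) =
  complex.Re z * complex.Im w + complex.Im z * complex.Re w.
Proof. by case: z w => ? ? []. Qed.

Lemma measC_real (u : R -> R) : measurable_fun I01 u -> measC (fun x => ((u x)%:C)%C).
Proof. by move=> mu_; split => //=; apply: measurable_cst. Qed.

Lemma measCD f g : measC f -> measC g -> measC (fun x => f x + g x).
Proof.
move=> [f1 f2] [g1 g2]; split.
  by under eq_fun do rewrite complexReD; apply: measurable_funD.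
by under eq_fun do rewrite complexImD; apply: measurable_funD.
Qed.

Lemma measCZ c f : measC f -> measC (fun x => c * f x).
Proof.
move=> [f1 f2]; split.
  under eq_fun do rewrite complexReM.
  by apply: measurable_funB; apply: measurable_funM => //; apply: measurable_cst.
under eq_fun do rewrite complexImM.
by apply: measurable_funD; apply: measurable_funM => //; apply: measurable_cst.
Qed.

Lemma measC0 : measC (fun=> 0).
Proof. by split; apply: measurable_cst. Qed.

Lemma measCB f g : measC f -> measC g -> measC (fun x => f x - g x).
Proof.
move=> mf mg; rewrite (_ : (fun x => _) = (fun x => f x + (-1) * g x)).
  by apply: measCD => //; apply: measCZ.
by apply/funext => x; rewrite mulN1r.
Qed.

Lemma measC_sum (T : Type) (r : seq T) (F : T -> R -> C) :
  (forall i, measC (F i)) -> measC (fun x => \sum_(i <- r) F i x).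
Proof.
move=> mF; elim: r => [|i r IH].
  by under eq_fun do rewrite big_nil; apply: measC0.
by under eq_fun do rewrite big_cons; apply: measCD.
Qed.

Lemma measurable_sqr_normc f : measC f ->
  measurable_fun I01 (fun x => ((normc (f x)) ^+ 2)%:E).
Proof.
move=> [f1 f2]; apply/measurable_EFinP.
under eq_fun do rewrite normcE2.
by apply: measurable_funD; apply: measurable_funX.
Qed.

Lemma eq_nrm2 f g : (forall x, I01 x -> f x = g x) -> sqnormI f = sqnormI g.
Proof. by move=> fg; apply: eq_integral => x; rewrite inE => Ix; rewrite fg. Qed.

Lemma nrm2Z c f : measC f -> sqnormI (fun x => c * f x) = ((normc c ^+ 2)%:E * sqnormI f)%E.
Proof.
move=> mf; rewrite /sqnormI -ge0_integralZl_EFin ?sqr_ge0 //.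
- by apply: eq_integral => x _; rewrite normcM exprMn.
- by move=> x _; rewrite lee_fin sqr_ge0.
- exact: measurable_sqr_normc.
Qed.

Lemma nrm2D f g : measC f -> measC g ->
  (sqnormI (fun x => (f x + g x)%R) <= 2%:E * sqnormI f + 2%:E * sqnormI g)%E.
Proof.
move=> mf mg.
have m2 h : measC h -> measurable_fun I01 (fun x => (2%:E * ((normc (h x)) ^+ 2)%:E)%E).
  by move=> mh; apply: measurable_funeM; apply: measurable_sqr_normc.
have p2 h x : (0 <= 2%:E * ((normc (h x)) ^+ 2)%:E)%E.
  by rewrite -EFinM lee_fin mulr_ge0 ?sqr_ge0.
rewrite /sqnormI -!ge0_integralZl_EFin //.
- rewrite -ge0_integralD //; do ?[by move=> x _; exact: p2 | exact: m2].
  apply: ge0_le_integral => //.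
  + by move=> x _; rewrite lee_fin sqr_ge0.
  + by apply: measurable_sqr_normc; apply: measCD.
  + by apply: emeasurable_funD; apply: m2.
  + by move=> x _; rewrite -!EFinM -EFinD lee_fin sqr_normcD.
- by move=> x _; rewrite lee_fin sqr_ge0.
- exact: measurable_sqr_normc.
- by move=> x _; rewrite lee_fin sqr_ge0.
- exact: measurable_sqr_normc.
Qed.

Lemma nrm2D_le f g (e : R) : measC f -> measC g ->
  (sqnormI f <= (e / 4)%:E)%E -> (sqnormI g <= (e / 4)%:E)%E ->
  (sqnormI (fun x => (f x + g x)%R) <= e%:E)%E.
Proof.
move=> mf mg hf hg; apply: le_trans (nrm2D mf mg) _.
apply: (@le_trans _ _ (2%:E * (e / 4)%:E + 2%:E * (e / 4)%:E)%E).
  by apply: leeD; apply: lee_wpmul2l => //; rewrite lee_fin.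
by rewrite -!EFinM -EFinD lee_fin; lra.
Qed.

Lemma nrm2Z_le c f (e : R) : 0 <= e -> measC f ->
  (sqnormI f <= (e / (normc c ^+ 2 + 1))%:E)%E -> (sqnormI (fun x => (c * f x)%R) <= e%:E)%E.
Proof.
move=> e0 mf hf; rewrite nrm2Z //.
have c0 := sqr_ge0 (normc c); have c1 : 0 < normc c ^+ 2 + 1 by rewrite ltr_wpDl.
apply: (@le_trans _ _ ((normc c ^+ 2)%:E * (e / (normc c ^+ 2 + 1))%:E)%E).
  by apply: lee_wpmul2l; rewrite ?lee_fin.
by rewrite -EFinM lee_fin mulrA ler_pdivrMr // mulrC; nra.
Qed.

Lemma nrm2_real (u : R -> R) :
  sqnormI (fun x => ((u x)%:C)%C) = (\int[mu]_(x in I01) (u x ^+ 2)%:E)%E.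
Proof. by apply: eq_integral => x _; rewrite normc_real real_normK // num_real. Qed.

Lemma measurable_frac2 (k : R) : measurable_fun [set: R] (fun x => frac2 (k * x)).
Proof.
have mk : measurable_fun [set: R] (fun x : R => k * x).
  by apply: measurable_funM => //; apply: measurable_cst.
apply: (measurableT_comp (f := @frac2 R)) => //.
rewrite /frac2; apply: measurable_funB => //.
apply: measurable_funM; first exact: measurable_cst.
apply: nondecreasing_measurable => // s t st.
by rewrite ler_int; apply: le_floor; rewrite ler_pM2r ?invr_gt0.
Qed.

(** A real-valued form of [odd_ext (step_fun a)], convenient for measurability. *)
Definition oddstep a (y : R) : R :=
  let z := frac2 y in
  if (0 < z) && (z < 1) then (if a < z then 1 else 0)
  else if (1 < z) && (z < 2) then (if a < 2 - z then -1 else 0) else 0.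

Lemma odd_ext_oddstep a y : odd_ext (step_fun a) y = ((oddstep a y)%:C)%C.
Proof.
rewrite /odd_ext /oddstep -/(frac2 y) /step_fun; move: (frac2 y) => z.
case: ifP => [/andP[z0 z1]|_].
  by rewrite z1 andbT; case: ifP.
case: ifP => // /andP[z1 z2].
rewrite (_ : 2 - z < 1) ?andbT; last by lra.
by case: ifP => _; rewrite ?rmorphN ?oppr0.
Qed.

Lemma measurable_oddstep a (k : R) : measurable_fun I01 (fun x => oddstep a (k * x)).
Proof.
apply: (@measurable_funS _ _ _ _ [set: R]) => //.
have mf := measurable_frac2 k.
have c (b : R) : measurable_fun [set: R] (fun x : R => b) by apply: measurable_cst.
rewrite /oddstep; apply: measurable_fun_ifT.
- by apply: measurable_and; apply: measurable_fun_ltr.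
- by apply: measurable_fun_ifT => //; apply: measurable_fun_ltr.
apply: measurable_fun_ifT => //.
- by apply: measurable_and; apply: measurable_fun_ltr.
apply: measurable_fun_ifT => //; apply: measurable_fun_ltr => //.
exact: measurable_funB.
Qed.

Lemma measurable_sin (w : R) : measurable_fun I01 (fun x => sin (w * x)).
Proof.
apply: (@measurable_funS _ _ _ _ [set: R]) => //.
apply: (measurableT_comp (f := @sin R)); first exact: continuous_measurable_fun (@continuous_sin R).
by apply: measurable_funM => //; apply: measurable_cst.
Qed.

Definition sinpart (b : nat -> C) N (y : R) : C :=
  \sum_(1 <= j < N.+1) b j * ((sin (pi * j%:R * y))%:C)%C.

Definition vanish (u : nat -> R -> C) := (forall N, measC (u N)) /\
  forall eps : R, 0 < eps -> exists N0, forall N, (N0 <= N)%N -> (sqnormI (u N) <= eps%:E)%E.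

Lemma vanish_lin c u v : vanish u -> vanish v -> vanish (fun N x => c * u N x + v N x).
Proof.
move=> [mu_ hu] [mv hv]; split=> [N|eps e0]; first by apply: measCD => //; apply: measCZ.
have e4 : 0 < eps / 4 by rewrite divr_gt0.
have c1 : 0 < normc c ^+ 2 + 1 by rewrite ltr_wpDl // sqr_ge0.
have [N1 hN1] := hu _ (divr_gt0 e4 c1); have [N2 hN2] := hv _ e4.
exists (maxn N1 N2) => N; rewrite geq_max => /andP[/hN1 {}hN1 /hN2 {}hN2].
apply: nrm2D_le => //; first exact: measCZ.
by apply: nrm2Z_le => //; exact: ltW.
Qed.

Lemma vanish0 : vanish (fun _ _ => 0).
Proof.
split=> [N|eps e0]; first exact: measC0.
exists 0%N => N _; rewrite /sqnormI; under eq_integral do rewrite ComplexField.Normc.normc0 expr0n /=.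
by rewrite integral0 lee_fin ltW.
Qed.

Lemma eq_vanish u v : (forall N x, u N x = v N x) -> vanish u -> vanish v.
Proof. by move=> uv; rewrite (_ : u = v) //; apply/funext => N; apply/funext => x. Qed.

Lemma vanish_sum (T : eqType) (r : seq T) (c : T -> C) (u : T -> nat -> R -> C) :
  (forall i, i \in r -> vanish (u i)) -> vanish (fun N x => \sum_(i <- r) c i * u i N x).
Proof.
elim: r => [|i r IH] h; first by apply: eq_vanish vanish0 => N x; rewrite big_nil.
apply: (@eq_vanish (fun N x => c i * u i N x + \sum_(j <- r) c j * u j N x)).
  by move=> N x; rewrite big_cons.
apply: vanish_lin; first by apply: h; rewrite mem_head.
by apply: IH => t tr; apply: h; rewrite in_cons tr orbT.
Qed.

(** Convergence on (0, 1) is required of every dilate, so that no change of variables is needed when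
    phi(kx) is approximated. *)
Definition sine_expansion phi (b : nat -> C) := forall k, (0 < k)%N ->
  measC (fun x => odd_ext phi (k%:R * x)) /\
  vanish (fun N x => odd_ext phi (k%:R * x) - sinpart b N (k%:R * x)).

Lemma measC_sinpart b N (k : R) : measC (fun x => sinpart b N (k * x)).
Proof.
apply: measC_sum => j; apply: measCZ; apply: measC_real.
by under eq_fun do rewrite mulrA; apply: measurable_sin.
Qed.

Lemma sine_expansion_stepf a : 0 <= a < 1 -> sine_expansion (step_fun a)
  (fun j => ((2 / (pi * j%:R) * (cos (pi * j%:R * a) - cos (pi * j%:R)))%:C)%C).
Proof.
move=> a01; have modd k : measC (fun x => odd_ext (step_fun a) (k%:R * x)).
  by under eq_fun do rewrite odd_ext_oddstep; apply: measC_real; apply: measurable_oddstep.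
move=> k k0; split=> //; split=> [N|eps e0]; first by apply: measCB => //; apply: measC_sinpart.
have k0' : k%:R != 0 :> R by rewrite pnatr_eq0 -lt0n.
have sE N x : sinpart (fun j => ((2 / (pi * j%:R) * (cos (pi * j%:R * a) - cos (pi * j%:R)))%:C)%C) N (k%:R * x)
   = ((step_partial a N (k%:R * x))%:C)%C.
  by rewrite steppartE rmorph_sum; apply: eq_bigr => j _; rewrite -rmorphM.
have nE N : sqnormI (fun x => odd_ext (step_fun a) (k%:R * x) - sinpart (fun j =>
    ((2 / (pi * j%:R) * (cos (pi * j%:R * a) - cos (pi * j%:R)))%:C)%C) N (k%:R * x)) =
    (\int[mu]_(x in I01) ((oddstep a (k%:R * x) - step_partial a N (k%:R * x)) ^+ 2)%:E)%E.
  by rewrite -nrm2_real; apply: eq_nrm2 => x _; rewrite sE odd_ext_oddstep -rmorphB.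
(* Three sawtooth errors of at most 2 + pi, with coefficients 1, 1, 2, divided by pi and squared. *)
pose B : R := (4 * (2 + pi) / pi) ^+ 2.
have [|||N0 hN0] := @dominated_small R (fun N x => oddstep a (k%:R * x) - step_partial a N (k%:R * x)) (fun=> B) _ _ _ eps e0.
- move=> N; apply: measurable_funB; first exact: measurable_oddstep.
  under eq_fun do rewrite steppartE.
  apply: measurable_sum => j; apply: measurable_funM; first exact: measurable_cst.
  by under eq_fun do rewrite mulrA; apply: measurable_sin.
- apply: (@integrable_bounded _ _ `|B|); first exact: measurable_cst.
  by move=> x _.
- have h0 := ae_frac2 0 k0'; have h1 := ae_frac2 1 k0'.
  have h2 := ae_frac2 (- a) k0'; have h3 := ae_frac2 a k0'.
  apply: ae_imp (ae_conj (ae_conj h0 h1) (ae_conj h2 h3)) => x [[]].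
  rewrite addr0 => f0 f1 [f2 f3] _.
  have -> : oddstep a (k%:R * x) = step_saw a (k%:R * x).
    by have := odd_ext_stepf a01 f0 f1 f2 f3; rewrite odd_ext_oddstep => -[].
  split=> [N|].
    rewrite -real_normK ?num_real // ler_sqr ?nnegrE //; last first.
      by rewrite divr_ge0 ?pi_ge0 // mulr_ge0 // addr_ge0 ?pi_ge0.
    exact: steppart_error_le.
  rewrite -(subrr (step_saw a (k%:R * x))); apply: cvgB; first exact: cvg_cst.
  exact: steppart_cvg.
by exists N0 => N NN0; rewrite nE; apply: hN0.
Qed.

Lemma odd_ext_lin c phi1 phi2 y :
  odd_ext (fun x => c * phi1 x + phi2 x) y = c * odd_ext phi1 y + odd_ext phi2 y.
Proof.
rewrite /odd_ext; case: ifP => // _; case: ifP => // _; last by rewrite mulr0 addr0.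
by rewrite opprD mulrN.
Qed.

Lemma odd_ext0 y : odd_ext (fun=> 0) y = 0 :> C.
Proof. by rewrite /odd_ext oppr0; case: ifP => // _; case: ifP. Qed.

Lemma odd_ext_sum (T : Type) (r : seq T) (c : T -> C) (phi : T -> R -> C) y :
  odd_ext (fun x => \sum_(i <- r) c i * phi i x) y = \sum_(i <- r) c i * odd_ext (phi i) y.
Proof.
elim: r => [|i r IH].
  rewrite big_nil (_ : (fun x => _) = fun=> 0); first exact: odd_ext0.
  by apply/funext => x; rewrite big_nil.
rewrite big_cons -IH -odd_ext_lin; congr odd_ext.
by apply/funext => x; rewrite big_cons.
Qed.

Lemma sinpart_sum (T : Type) (r : seq T) (c : T -> C) (b : T -> nat -> C) N y :
  sinpart (fun j => \sum_(i <- r) c i * b i j) N y = \sum_(i <- r) c i * sinpart (b i) N y.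
Proof.
rewrite /sinpart; under eq_bigr do rewrite mulr_suml.
rewrite exchange_big /=; apply: eq_bigr => i _; rewrite mulr_sumr.
by apply: eq_bigr => j _; rewrite mulrA.
Qed.

Lemma sine_expansion_sum (T : eqType) (r : seq T) (c : T -> C) (phi : T -> R -> C) (b : T -> nat -> C) :
  (forall i, i \in r -> sine_expansion (phi i) (b i)) ->
  sine_expansion (fun x => \sum_(i <- r) c i * phi i x) (fun j => \sum_(i <- r) c i * b i j).
Proof.
move=> h k k0; split.
  under eq_fun do rewrite odd_ext_sum; elim: r h => [|i r IH] h.
    by under eq_fun do rewrite big_nil; apply: measC0.
  under eq_fun do rewrite big_cons; apply: measCD.
    by apply: measCZ; have [] := h i (mem_head i r) k k0.
  by apply: IH => t tr; apply: h; rewrite in_cons tr orbT.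
have := @vanish_sum _ r c (fun i N x => odd_ext (phi i) (k%:R * x) - sinpart (b i) N (k%:R * x)).
move=> /(_ (fun i ir => (h i ir k k0).2)); apply: eq_vanish => N x.
by rewrite odd_ext_sum sinpart_sum -sumrB; apply: eq_bigr => i _; rewrite mulrBr.
Qed.

End SineExpansions.

(** * Bessel bound for sine polynomials *)

Section Orthogonality.
Local Open Scope classical_set_scope.
Variable R : realType.
Local Notation C := R[i].
Local Notation mu := (@lebesgue_measure R).
Local Notation I01 := (@I01 R).
Implicit Types (x a b : R).
Hint Extern 0 (measurable _) => solve [exact: mI01] : core.

Lemma is_derive_sum_seq (T : Type) (s : seq T) (F dF : T -> R -> R) x :
  (forall i, is_derive x (1 : R) (F i) (dF i x)) ->
  is_derive x (1 : R) (fun y => \sum_(i <- s) F i y) (\sum_(i <- s) dF i x).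
Proof.
move=> h; elim: s => [|i s IH].
  rewrite big_nil (_ : (fun y => _) = cst 0); last by apply/funext => y; rewrite big_nil.
  exact: is_derive_cst.
rewrite big_cons (_ : (fun y => _) = (F i) + (fun y => \sum_(j <- s) F j y)).
  exact: is_deriveD.
by apply/funext => y; rewrite big_cons.
Qed.

Lemma is_derive_continuous (f df : R -> R) :
  (forall x, is_derive x (1 : R) f (df x)) -> continuous f.
Proof.
move=> h x; apply: differentiable_continuous; apply/derivable1_diffP.
exact: (@ex_derive _ _ _ _ _ _ _ (h x)).
Qed.

Lemma integral_FTC (F f : R -> R) : (forall x, is_derive x (1 : R) F (f x)) ->
  continuous f -> (\int[mu]_(x in I01) (f x)%:E = (F 1 - F 0)%:E)%E.
Proof.
move=> dF cf; have cF := is_derive_continuous dF.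
rewrite -(@integral_itv_bndoo _ 0 1 _ true false); last first.
  apply/measurable_EFinP; apply: (@measurable_funS _ _ _ _ [set: R]) => //.
  exact: continuous_measurable_fun.
rewrite (@continuous_FTC2 _ f F) ?EFinB //.
- exact: continuous_subspaceT.
- split=> [x _||].
  + exact: (@ex_derive _ _ _ _ _ _ _ (dF x)).
  + by apply: cvg_at_right_filter; apply: cF.
  + by apply: cvg_at_left_filter; apply: cF.
- by move=> x _; rewrite derive1E; apply: (@derive_val _ _ _ _ _ _ _ (dF x)).
Qed.

(** Antiderivative of sin (ax) sin (bx). If a = b the middle term is 0 by the convention on division
    by 0, and x/2 replaces it. *)
Definition sinprod a b x : R :=
  (if a == b then x / 2 else 0) + sin ((a - b) * x) / (2 * (a - b)) - sin ((a + b) * x) / (2 * (a + b)).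

Lemma is_derive_sinprod a b x : 0 < a -> 0 < b ->
  is_derive x (1 : R) (sinprod a b) (sin (a * x) * sin (b * x)).
Proof.
move=> a0 b0; have ab0 : a + b != 0 by rewrite gt_eqF // addr_gt0.
have d1 : is_derive x (1 : R) (fun y => if a == b then y / 2 else 0) (if a == b then 2^-1 else 0).
  case: ifP => _; last exact: is_derive_cst.
  rewrite (_ : (fun y => _) = 2^-1 *: id); last by apply/funext => y; rewrite /GRing.scale /= mulrC.
  by apply: (is_derive_eq (is_deriveZ 2^-1 (is_derive_id x 1))); rewrite scaler1.
have ds c : is_derive x (1 : R) (fun y => sin (c * y) / (2 * c)) (c / (2 * c) * cos (c * x)).
  rewrite (_ : (fun y => _) = (2 * c)^-1 *: (fun y => sin (c * y))); last first.
    by apply/funext => y; rewrite /GRing.scale /= mulrC.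
  apply: (is_derive_eq (is_deriveZ (2 * c)^-1 (is_derive_sinM c x))).
  by rewrite /GRing.scale /= mulrA (mulrC _^-1).
apply: (is_derive_eq (is_deriveB (is_deriveD d1 (ds (a - b))) (ds (a + b)))).
have c0 c : c != 0 -> c / (2 * c) = 2^-1 :> R by move=> c0; field.
rewrite (c0 (a + b)) //.
have e1 : cos ((a + b) * x) = cos (a * x) * cos (b * x) - sin (a * x) * sin (b * x).
  by rewrite mulrDl cosD.
have e2 : cos ((a - b) * x) = cos (a * x) * cos (b * x) + sin (a * x) * sin (b * x).
  by rewrite mulrBl cosD cosN sinN; ring.
rewrite e1; have [->|ab] := eqVneq a b.
  have := cos2Dsin2 (b * x); rewrite subrr mul0r mul0r addr0.
  by move: (cos _) (sin _) => u v; nra.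
rewrite c0 ?subr_eq0 // e2; move: (cos _) (cos _) (sin _) (sin _) => u v w z; by field.
Qed.

Lemma sin_pi_int (z : int) : sin (pi * z%:~R) = 0 :> R.
Proof.
have nat_case k : sin (pi * k%:R) = 0 :> R.
  elim: k => [|k IH]; first by rewrite mulr0 sin0.
  by rewrite -natr1 mulrDr mulr1 sinDpi IH oppr0.
case: z => k; first by rewrite -pmulrn nat_case.
by rewrite NegzE rmorphN /= mulrN sinN nat_case oppr0.
Qed.

(** The frequencies are distinct positive multiples of pi, so in the antiderivative at 0 and 1 all
    sine terms vanish and each diagonal pair gives one half. *)
Lemma sine_bessel (r : nat -> R) N l : (0 < l)%N ->
  (\int[mu]_(x in I01) ((\sum_(1 <= n < N.+1) r n * sin (pi * n%:R * (l%:R * x))) ^+ 2)%:E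
    <= (\sum_(1 <= n < N.+1) r n ^+ 2)%:E)%E.
Proof.
move=> l0; have l0' : 0 < l%:R :> R by rewrite ltr0n.
pose w n : R := pi * n.+1%:R * l%:R.
have w0 n : 0 < w n by rewrite !mulr_gt0 ?pi_gt0.
pose s n x := r n.+1 * sin (w n * x).
have sE x : \sum_(1 <= n < N.+1) r n * sin (pi * n%:R * (l%:R * x)) = \sum_(0 <= n < N) s n x.
  by rewrite big_add1; apply: eq_bigr => n _; rewrite /s /w mulrA.
under eq_integral do rewrite sE.
pose F x := \sum_(0 <= n < N) \sum_(0 <= m < N) r n.+1 * r m.+1 * sinprod (w n) (w m) x.
have dF x : is_derive x (1 : R) F ((\sum_(0 <= n < N) s n x) ^+ 2).
  rewrite expr2 big_distrlr /=.
  apply: (@is_derive_sum_seq _ _ (fun n y => \sum_(0 <= m < N) r n.+1 * r m.+1 * sinprod (w n) (w m) y)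
    (fun n y => \sum_(0 <= m < N) s n y * s m y)) => n.
  apply: (@is_derive_sum_seq _ _ (fun m y => r n.+1 * r m.+1 * sinprod (w n) (w m) y)
    (fun m y => s n y * s m y)) => m.
  rewrite (_ : s n x * s m x = r n.+1 * r m.+1 *: (sin (w n * x) * sin (w m * x))); last first.
    by rewrite /s /GRing.scale /=; ring.
  by apply: is_deriveZ; apply: is_derive_sinprod.
have cT2 : continuous (fun x => (\sum_(0 <= n < N) s n x) ^+ 2).
  pose dT x := \sum_(0 <= n < N) r n.+1 *: (w n * cos (w n * x)).
  have dS x : is_derive x (1 : R) (fun x => \sum_(0 <= n < N) s n x) (dT x).
    by apply: (@is_derive_sum_seq _ _ s (fun n y => r n.+1 *: (w n * cos (w n * y)))) => n; apply: is_deriveZ; apply: is_derive_sinM.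
  have cT := is_derive_continuous dS.
  by move=> x; rewrite (_ : (fun x => _) = (fun x => \sum_(0 <= n < N) s n x) \* (fun x => \sum_(0 <= n < N) s n x));
    [apply: cvgM; apply: cT | apply/funext => y; rewrite expr2].
rewrite (integral_FTC dF cT2) /F.
rewrite lee_fin -sumrB big_add1; apply: ler_sum => n _; rewrite -sumrB.
rewrite (eq_bigr (fun m => if m == n then r n.+1 ^+ 2 / 2 else 0)) => [|m _]; last first.
  have wB : w n - w m = pi * ((n.+1%:Z - m.+1%:Z) * l%:Z)%:~R.
    by rewrite /w intrM intrB -!pmulrn; ring.
  have wD : w n + w m = pi * ((n.+1%:Z + m.+1%:Z) * l%:Z)%:~R.
    by rewrite /w intrM intrD -!pmulrn; ring.
  rewrite -mulrBr /sinprod !mulr0 sin0 !mulr1 {1}wB {1}wD !sin_pi_int !mul0r !subr0 !addr0.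
  rewrite (_ : (w n == w m) = (m == n)).
    by case: eqP => [->|_]; rewrite ?subr0 ?mul0r ?subrr ?mulr0 //; field.
  apply/eqP/eqP => [|->//]; rewrite /w.
  by move/(mulIf (lt0r_neq0 l0'))/(mulfI (lt0r_neq0 (pi_gt0 R)))/eqP; rewrite eqr_nat eqSS => /eqP ->.
by apply: le_trans (sum_pick_le _ _ _ _) _; have := sqr_ge0 (r n.+1); lra.
Qed.

End Orthogonality.

(** * Density of sine polynomials *)

Section Completeness.
Local Open Scope classical_set_scope.
Variable R : realType.
Local Notation C := R[i].
Local Notation mu := (@lebesgue_measure R).
Local Notation I01 := (@I01 R).
Implicit Types (x a b : R).
Hint Extern 0 (measurable _) => solve [exact: mI01] : core.

Definition clip (M y : R) : R := Num.max (- M) (Num.min y M).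

Lemma clip_id M y : `|y| <= M -> clip M y = y.
Proof.
rewrite ler_norml => /andP[h1 h2]; rewrite /clip.
by rewrite min_l // max_r.
Qed.

Lemma clip_le M y : 0 <= M -> `|clip M y| <= M.
Proof.
move=> M0; rewrite /clip ler_norml le_max lexx /= ge_max ge_min lexx orbT andbT.
by lra.
Qed.

Lemma clip_lip M y z : 0 <= M -> `|clip M y - clip M z| <= `|y - z|.
Proof.
move=> M0; wlog yz : y z / z <= y.
  by have [yz /(_ _ _ yz)|zy /(_ _ _ (ltW zy))] := leP z y; rewrite // distrC (distrC y).
rewrite (ger0_norm (_ : 0 <= y - z)) ?subr_ge0 // /clip ler_norml.
case: (leP y M) => h1; case: (leP z M) => h2.
- by case: (leP (- M) y) => h3; case: (leP (- M) z) => h4; apply/andP; split; lra.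
- by case: (leP (- M) y) => h3; case: (leP (- M) M) => h4; apply/andP; split; lra.
- by case: (leP (- M) M) => h3; case: (leP (- M) z) => h4; apply/andP; split; lra.
- by case: (leP (- M) M) => h3; apply/andP; split; lra.
Qed.

Lemma clip_err M y : 0 <= M -> (y - clip M y) ^+ 2 <= y ^+ 2.
Proof.
move=> M0; rewrite /clip; case: (leP y M) => h1.
  case: (leP (- M) y) => h2; first by rewrite subrr expr0n sqr_ge0.
  by rewrite -subr_ge0 (_ : _ - _ = M * (- (2 * y) - M)); [rewrite mulr_ge0 //; lra | ring].
case: (leP (- M) M) => h2; last by lra.
by rewrite -subr_ge0 (_ : _ - _ = M * (2 * y - M)); [rewrite mulr_ge0 //; lra | ring].
Qed.

Lemma measurable_clip M : measurable_fun [set: R] (clip M).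
Proof.
apply: nondecreasing_measurable => // y z yz.
have mm : Num.min y M <= Num.min z M by rewrite le_min !ge_min yz lexx orbT.
by rewrite /clip ge_max !le_max lexx mm orbT.
Qed.

Lemma step_cell n x : (0 < n)%N -> 0 < x < 1 ->
  exists i, [/\ (i < n)%N, i%:R / n%:R < x & x <= i.+1%:R / n%:R].
Proof.
move=> n0 /andP[x0 x1]; have n0' : 0 < n%:R :> R by rewrite ltr0n.
have ex : exists k, x <= k.+1%:R / n%:R.
  by exists n.-1; rewrite prednK // divff ?gt_eqF // ltW.
case: (ex_minnP ex) => i xi imin.
exists i; split=> //.
  have : (i <= n.-1)%N by apply: imin; rewrite prednK // divff ?gt_eqF // ltW.
  by lia.
case: i xi imin => [|i] xi imin; first by rewrite mul0r.
by rewrite ltNge; apply/negP => /imin; rewrite ltnn.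
Qed.

(** Abel summation: the jumps that write a staircase with value v i on (i/n, (i+1)/n] through
    indicators of intervals ending at 1. *)
Definition bwd_diff (v : nat -> R) i : R := if i is j.+1 then v i - v j else v 0%N.

Definition stair (v : nat -> R) n x : R :=
  \sum_(0 <= i < n) bwd_diff v i * (if i%:R / n%:R < x then 1 else 0).

Lemma stair_cell v n x i : (0 < n)%N -> (i < n)%N ->
  i%:R / n%:R < x -> x <= i.+1%:R / n%:R -> stair v n x = v i.
Proof.
move=> n0 iN ix xi; have n0' : 0 < n%:R :> R by rewrite ltr0n.
have tail0 : \sum_(i.+1 <= j < n) bwd_diff v j * (if j%:R / n%:R < x then 1 else 0) = 0.
  rewrite big_nat big1 // => j /andP[ij _]; rewrite ifF ?mulr0 //; apply/negbTE; rewrite -leNgt.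
  by apply: le_trans xi _; rewrite ler_pM2r ?invr_gt0 // ler_nat.
rewrite /stair (@big_cat_nat _ _ _ i.+1) //= tail0 addr0.
rewrite (eq_big_nat _ _ (F2 := bwd_diff v)); last first.
  move=> j /andP[_ ji]; rewrite ifT ?mulr1 //; apply: le_lt_trans ix.
  by rewrite ler_pM2r ?invr_gt0 // ler_nat -ltnS.
elim: (i) => [|k IH]; first by rewrite big_nat1.
by rewrite big_nat_recr //= IH addrC subrK.
Qed.

Lemma measurable_step a : measurable_fun I01 (fun x => if a < x then 1 else 0 : R).
Proof.
apply: (@measurable_funS _ _ _ _ [set: R]) => //.
have c (b : R) : measurable_fun [set: R] (fun x : R => b) by apply: measurable_cst.
by apply: measurable_fun_ifT => //; apply: measurable_fun_ltr.
Qed.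

Lemma measurable_stair v n : measurable_fun I01 (stair v n).
Proof.
apply: measurable_sum => i; apply: measurable_funM; first exact: measurable_cst.
exact: measurable_step.
Qed.

Lemma sqint_add_le (u v : R -> R) (e : R) : measurable_fun I01 u -> measurable_fun I01 v ->
  (\int[mu]_(x in I01) (u x ^+ 2)%:E <= (e / 4)%:E)%E ->
  (\int[mu]_(x in I01) (v x ^+ 2)%:E <= (e / 4)%:E)%E ->
  (\int[mu]_(x in I01) ((u x + v x) ^+ 2)%:E <= e%:E)%E.
Proof.
move=> mu_ mv; rewrite -!nrm2_real => hu hv.
rewrite (@eq_nrm2 _ _ (fun x => (u x)%:C%C + (v x)%:C%C)); last by move=> x _; rewrite rmorphD.
by apply: nrm2D_le => //; apply: measC_real.
Qed.

(** Three approximations: g by its truncation, the truncation by a continuous function, and that one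
    by staircases sampling it at left endpoints. *)
Lemma step_approx (g : R -> R) (eps : R) : measurable_fun I01 g ->
  (\int[mu]_(x in I01) (g x ^+ 2)%:E < +oo)%E -> 0 < eps ->
  exists v n, (0 < n)%N /\
    (\int[mu]_(x in I01) ((g x - stair v n x) ^+ 2)%:E <= eps%:E)%E.
Proof.
move=> mg ig e0; have e4 : 0 < eps / 4 by rewrite divr_gt0.
have e16 : 0 < eps / 4 / 4 by rewrite divr_gt0.
have mclip M (f : R -> R) : measurable_fun I01 f -> measurable_fun I01 (fun x => clip M (f x)).
  by move=> mf; apply: (measurableT_comp (f := clip M)) => //; apply: measurable_clip.
have ig2 : mu.-integrable I01 (EFin \o (fun x => g x ^+ 2)).
  apply/integrableP; split; first by apply/measurable_EFinP; apply: measurable_funX.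
  by under eq_integral do rewrite /= ger0_norm ?sqr_ge0 //.
have [||M0 hM] := @dominated_small R (fun N x => g x - clip N%:R (g x)) (fun x => g x ^+ 2) _ ig2 _ _ e4.
- by move=> N; apply: measurable_funB => //; apply: mclip.
- apply: aeW => x Ix; split=> [N|]; first exact: clip_err.
  apply: cvg_near_cst; exists (Num.truncn `|g x|).+1 => // N /= hN.
  rewrite clip_id ?subrr //; apply: ltW; apply: lt_le_trans (truncnS_gt _) _.
  by rewrite ler_nat.
pose M : R := M0.+1%:R; have Mgt0 : 0 < M by rewrite ltr0n.
have {}hM := hM M0.+1 (leqnSn _).
pose gM x := clip M (g x).
have mgM : measurable_fun I01 gM by apply: mclip.
have igM : mu.-integrable I01 (EFin \o gM).
  by apply: (@integrable_bounded _ _ M) => // x _; apply: clip_le; apply: ltW.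
have [|h_ [ch _ cvh]] := @approximation_continuous_integrable R I01 gM (@mI01 R) _ igM; first by rewrite [X in (X < _)%E]muI01 ltry.
(* The factor 2M converts L1 into L2 closeness: both functions lie in [-M, M], so (gM - k)^2 <= 2M
   |gM - k|. *)
have d0 : 0 < eps / 4 / 4 / (2 * M) by rewrite divr_gt0 // mulr_gt0.
have [h [cth mh hh]] : exists h : R -> R, [/\ continuous h, measurable_fun I01 h &
    (\int[mu]_(x in I01) `|gM x - h x|%:E <= (eps / 4 / 4 / (2 * M))%:E)%E].
  move/fine_cvgP: cvh => [[N1 _ h1]] /cvgrPdist_le /(_ _ d0) [N2 _ h2].
  pose N := maxn N1 N2; exists (h_ N); split=> //.
    by apply: (@measurable_funS _ _ _ _ [set: R]) => //; apply: continuous_measurable_fun.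
  have := h1 N (leq_maxl _ _); have := h2 N (leq_maxr _ _) => /=.
  rewrite sub0r normrN => h2N fN; rewrite -(fineK fN) lee_fin.
  exact: le_trans (ler_norm _) h2N.
(* Clipping h restores the bound M and, being 1-Lipschitz, moves it no farther from gM. *)
pose k x := clip M (h x).
have mk : measurable_fun I01 k by apply: mclip.
have hk : (\int[mu]_(x in I01) ((gM x - k x) ^+ 2)%:E <= (eps / 4 / 4)%:E)%E.
  apply: (@le_trans _ _ (\int[mu]_(x in I01) ((2 * M)%:E * `|gM x - h x|%:E))%E).
    apply: ge0_le_integral => //.
    - by move=> x _; rewrite lee_fin sqr_ge0.
    - by apply/measurable_EFinP; apply: measurable_funX; apply: measurable_funB.
    - apply: measurable_funeM; apply/measurable_EFinP.
      by apply: (measurableT_comp (f := fun y : R => `|y|)) => //; apply: measurable_funB.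
    - move=> x _; rewrite -EFinM lee_fin -real_normK ?num_real // expr2.
      have gE : gM x = clip M (gM x) by rewrite clip_id // clip_le // ltW.
      apply: ler_pM => //; last by rewrite {1}gE; apply: clip_lip; apply: ltW.
      apply: le_trans (ler_normB _ _) _; rewrite mulr2n mulrDl mul1r.
      by apply: lerD; apply: clip_le; apply: ltW.
  rewrite ge0_integralZl_EFin //; last first.
  - by rewrite mulr_ge0 // ltW.
  - by apply/measurable_EFinP; apply: (measurableT_comp (f := fun y : R => `|y|)) => //; apply: measurable_funB.
  apply: le_trans (lee_wpmul2l _ hh) _; first by rewrite lee_fin mulr_ge0 // ltW.
  by rewrite -EFinM lee_fin mulrC divfK // mulf_neq0 // gt_eqF.
pose v n i := clip M (h (i%:R / n.+1%:R)).
have [|||N hN] := @dominated_small R (fun n x => k x - stair (v n) n.+1 x) (fun=> (2 * M) ^+ 2) _ _ _ _ e16.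
- by move=> n; apply: measurable_funB => //; apply: measurable_stair.
- apply: (@integrable_bounded _ _ ((2 * M) ^+ 2)); first exact: measurable_cst.
  by move=> x _; rewrite ger0_norm ?sqr_ge0.
- apply: aeW => x; rewrite I01E => Ix.
  have cell n := @step_cell n.+1 x isT Ix.
  split=> [n|].
    have [i [iN ix xi]] := cell n; rewrite (stair_cell _ _ iN ix xi) //.
    rewrite -real_normK ?num_real // ler_sqr ?nnegrE ?mulr_ge0 ?(ltW Mgt0) //.
    apply: le_trans (ler_normB _ _) _; rewrite mulr2n mulrDl mul1r.
    by apply: lerD; apply: clip_le; apply: ltW.
  apply/cvgrPdist_le => e ee0.
  have /cvgrPdist_le /(_ e ee0) := cth x.
  case=> d /= d0' hd.
  exists (Num.truncn d^-1) => // n /= hn.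
  have [i [iN ix xi]] := cell n; rewrite (stair_cell _ _ iN ix xi) // sub0r normrN.
  apply: le_trans (clip_lip _ _ (ltW Mgt0)) _; apply: hd => /=.
  have n0 : 0 < n.+1%:R :> R by rewrite ltr0n.
  have dn : n.+1%:R^-1 < d.
    rewrite -[d]invrK ltf_pV2 ?posrE ?invr_gt0 //.
    by apply: lt_le_trans (truncnS_gt _) _; rewrite ler_nat ltnS.
  rewrite ger0_norm ?subr_ge0 ?(ltW ix) //; apply: le_lt_trans dn.
  by rewrite lerBlDr -[X in _ <= X + _]mul1r -mulrDl addrC natr1.
exists (v N), N.+1; split=> //.
have -> : (\int[mu]_(x in I01) ((g x - stair (v N) N.+1 x) ^+ 2)%:E =
  \int[mu]_(x in I01) (((g x - gM x) + ((gM x - k x) + (k x - stair (v N) N.+1 x))) ^+ 2)%:E)%E.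
  by apply: eq_integral => x _; congr (_ ^+ 2)%:E; ring.
apply: sqint_add_le => //.
- exact: measurable_funB.
- by apply: measurable_funD; apply: measurable_funB => //; apply: measurable_stair.
apply: sqint_add_le => //.
- exact: measurable_funB.
- by apply: measurable_funB => //; apply: measurable_stair.
- exact: hN.
Qed.

End Completeness.

(** * From closed spans of sequences to cyclic functions *)

Section Cyclicity.
Local Open Scope classical_set_scope.
Variable R : realType.
Local Notation C := R[i].
Local Notation mu := (@lebesgue_measure R).
Local Notation I01 := (@I01 R).
Implicit Types (x a : R) (f g phi : R -> C) (s : seq (nat * C)).
Hint Extern 0 (measurable _) => solve [exact: mI01] : core.

Lemma L2_measC f : L2 f -> measC f.
Proof. by case. Qed.

Lemma odd_ext_I01 phi x : I01 x -> odd_ext phi x = phi x.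
Proof.
rewrite I01E => x01; rewrite /odd_ext -/(frac2 x) (@frac2_eq _ x 0) ?x01 //; last by rewrite mulr0 addr0.
by move: x01 => /andP[x0 x1]; apply/andP; split; lra.
Qed.

Lemma normc_i : normc ('i%C : C) = 1.
Proof. by rewrite /= expr0n /= add0r expr1n sqrtr1. Qed.

Lemma measC_stepf a : measC (step_fun a).
Proof.
have c (b : R) : measurable_fun [set: R] (fun x : R => b) by apply: measurable_cst.
have m01 : measurable_fun I01 (fun x => if (a < x) && (x < 1) then 1 else 0 : R).
  apply: (@measurable_funS _ _ _ _ [set: R]) => //.
  by apply: measurable_fun_ifT => //; apply: measurable_and; apply: measurable_fun_ltr.
rewrite (_ : step_fun a = (fun x => ((if (a < x) && (x < 1) then 1 else 0)%:C)%C)).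
  exact: measC_real.
by apply/funext => x; rewrite /step_fun; case: ifP.
Qed.

Definition stepcomb (t : seq (R * C)) x : C := \sum_(e <- t) e.2 * step_fun e.1 x.

Lemma stepf_I01 a x : I01 x -> step_fun a x = ((if a < x then 1 else 0)%:C)%C.
Proof. by rewrite I01E /step_fun => /andP[_ ->]; rewrite andbT; case: ifP. Qed.

Lemma step_approxC f (eps : R) : L2 f -> 0 < eps ->
  exists t : seq (R * C), (forall e, e \in t -> 0 <= e.1 < 1) /\
    (sqnormI (fun x => f x - stepcomb t x)%R <= eps%:E)%E.
Proof.
move=> [m1 m2 fin] e0; have e4 : 0 < eps / 4 by rewrite divr_gt0.
have part (u : R -> R) : measurable_fun I01 u ->
    (forall x, u x ^+ 2 <= normc (f x) ^+ 2) -> (\int[mu]_(x in I01) (u x ^+ 2)%:E < +oo)%E.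
  move=> mu_ uf; apply: le_lt_trans fin; apply: ge0_le_integral => //.
  - by move=> x _; rewrite lee_fin sqr_ge0.
  - by apply/measurable_EFinP; apply: measurable_funX.
  - exact: measurable_sqr_normc.
  - by move=> x _; rewrite lee_fin.
have [|v1 [n1 [n10 h1]]] := @step_approx R (fun x => complex.Re (f x)) (eps / 4) m1 _ e4.
  by apply: part => // x; rewrite normcE2 lerDl sqr_ge0.
have [|v2 [n2 [n20 h2]]] := @step_approx R (fun x => complex.Im (f x)) (eps / 4) m2 _ e4.
  by apply: part => // x; rewrite normcE2 lerDr sqr_ge0.
exists ([seq (i%:R / n1%:R, ((bwd_diff v1 i)%:C)%C) | i <- iota 0 n1] ++
        [seq (i%:R / n2%:R, 'i%C * ((bwd_diff v2 i)%:C)%C) | i <- iota 0 n2]); split.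
  have it n i : (0 < n)%N -> i \in iota 0 n -> 0 <= (i%:R / n%:R : R) < 1.
    move=> n0; rewrite mem_iota add0n => /andP[_ iN].
    by rewrite divr_ge0 //= ltr_pdivrMr ?ltr0n // mul1r ltr_nat.
  by move=> e; rewrite mem_cat => /orP[] /mapP[i ii ->] /=; apply: it.
rewrite (@eq_nrm2 _ _ (fun x => ((complex.Re (f x) - stair v1 n1 x)%:C)%C +
   'i%C * ((complex.Im (f x) - stair v2 n2 x)%:C)%C)); last first.
  move=> x Ix; rewrite /stepcomb big_cat !big_map /= {1}[f x]complexE.
  have st v n (c : C) : \sum_(j <- iota 0 n) c * ((bwd_diff v j)%:C)%C * step_fun (j%:R / n%:R) x =
      c * ((stair v n x)%:C)%C.
    rewrite /stair rmorph_sum mulr_sumr /index_iota subn0; apply: eq_bigr => j _.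
    by rewrite stepf_I01 // rmorphM mulrA.
  rewrite st; under eq_bigr do rewrite -[((bwd_diff v1 _)%:C)%C]mul1r.
  by rewrite st !rmorphB /=; ring.
apply: nrm2D_le.
- by apply: measC_real; apply: measurable_funB => //; apply: measurable_stair.
- by apply: measCZ; apply: measC_real; apply: measurable_funB => //; apply: measurable_stair.
- by rewrite nrm2_real.
- rewrite nrm2Z; last by apply: measC_real; apply: measurable_funB => //; apply: measurable_stair.
  by rewrite normc_i expr1n mul1e nrm2_real.
Qed.

(** Step functions are dense, and each is the L2 limit of its own sine polynomials. *)
Lemma sine_complete f (eps : R) : L2 f -> 0 < eps ->
  exists N b, (sqnormI (fun x => f x - sinpart b N x)%R <= eps%:E)%E.
Proof.
move=> Lf e0; have e4 : 0 < eps / 4 by rewrite divr_gt0.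
have [t [t01 ht]] := step_approxC Lf e4.
have se := @sine_expansion_sum R _ t (fun e => e.2) (fun e => step_fun e.1) _
  (fun e et => sine_expansion_stepf (t01 e et)).
have [mS [_ /(_ _ e4)[N /(_ N (leqnn N)) hN]]] := se 1%N isT.
set b := (X in sinpart X) in hN; exists N, b.
have SE x : I01 x -> odd_ext (stepcomb t) (1%:R * x) = stepcomb t x.
  by move=> Ix; rewrite mul1r odd_ext_I01.
have mT : measC (stepcomb t).
  by apply: measC_sum => e; apply: measCZ; apply: measC_stepf.
rewrite (@eq_nrm2 _ _ (fun x => (f x - stepcomb t x) + (odd_ext (stepcomb t) (1%:R * x) - sinpart b N (1%:R * x)))); last first.
  by move=> x Ix; rewrite SE // mul1r addrA subrK.
apply: nrm2D_le => //.
- by apply: measCB => //; apply: L2_measC.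
- by apply: measCB => //; apply: measC_sinpart.
Qed.

Lemma sinpart_bound c N l : (0 < l)%N ->
  (sqnormI (fun x => sinpart c N (l%:R * x)) <= (sqnorm N c)%:E)%E.
Proof.
move=> l0; rewrite /sqnormI.
have sE x : normc (sinpart c N (l%:R * x)) ^+ 2 =
  (\sum_(1 <= n < N.+1) complex.Re (c n) * sin (pi * n%:R * (l%:R * x))) ^+ 2 +
  (\sum_(1 <= n < N.+1) complex.Im (c n) * sin (pi * n%:R * (l%:R * x))) ^+ 2.
  rewrite normcE2 /sinpart; congr (_ ^+ 2 + _ ^+ 2).
    elim/big_rec2: _ => // n u v _ <-; rewrite complexReD complexReM /=; ring.
  by elim/big_rec2: _ => // n u v _ <-; rewrite complexImD complexImM /=; ring.
under eq_integral do rewrite sE EFinD.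
have ms (r : nat -> R) : measurable_fun I01
    (fun x => ((\sum_(1 <= n < N.+1) r n * sin (pi * n%:R * (l%:R * x))) ^+ 2)%:E).
  apply/measurable_EFinP; apply: measurable_funX; apply: measurable_sum => n.
  apply: measurable_funM; first exact: measurable_cst.
  by under eq_fun do rewrite mulrA; apply: measurable_sin.
rewrite ge0_integralD //; do ?[by move=> x _; rewrite lee_fin sqr_ge0 | exact: ms].
rewrite /sqnorm; under eq_bigr do rewrite normcE2.
by rewrite big_split EFinD; apply: leeD; apply: sine_bessel.
Qed.

(** The frequencies kj <= N are those with j <= N / k, so the truncation point depends on the
    dilation. *)
Lemma sinpart_dil (b : nat -> C) k N y : (0 < k)%N ->
  sinpart (dilate k b) N y = sinpart b (N %/ k) (k%:R * y).
Proof.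
move=> k0; rewrite /sinpart; symmetry.
pose G j n : C := if n == (k * j)%N then b j * ((sin (pi * n%:R * y))%:C)%C else 0.
transitivity (\sum_(1 <= j < (N %/ k).+1) \sum_(1 <= n < N.+1) G j n).
  apply: eq_big_nat => j /andP[j1 jN].
  have jin : (k * j)%N \in index_iota 1 N.+1.
    rewrite mem_index_iota muln_gt0 k0 j1 /= ltnS mulnC.
    by apply: leq_trans (leq_trunc_div N k); rewrite leq_pmul2r.
  rewrite (big_rem _ jin) /= /G eqxx big1_seq ?addr0.
    by congr (_ * (sin _)%:C%C); rewrite natrM; ring.
  move=> n /andP[_ nr]; rewrite ifF //; apply: contraTF nr => /eqP ->.
  by rewrite mem_rem_uniqF ?iota_uniq.
rewrite exchange_big /=; apply: eq_big_nat => n /andP[n1 nN].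
rewrite /dilate; case: ifPn => [/dvdnP[j nE]|kn]; last first.
  rewrite mul0r big1 // => j _; rewrite /G ifF //; apply: contraNF kn => /eqP ->.
  exact: dvdn_mulr.
have jin : j \in index_iota 1 (N %/ k).+1.
  rewrite mem_index_iota ltnS leq_divRL //; move: n1 nN; rewrite nE.
  by case: (j) => //= m; lia.
rewrite (big_rem _ jin) /= /G nE (mulnC j) eqxx mulKn // big1_seq ?addr0 //.
move=> i /andP[_ ir]; rewrite ifF //; apply/negP; rewrite eqn_pmul2l // => /eqP ji.
by move: ir; rewrite -ji mem_rem_uniqF ?iota_uniq.
Qed.

Definition oddcomb phi s x : C := \sum_(e <- s) e.2 * odd_ext phi (e.1%:R * x).

Definition approximable phi g := forall eps : R, 0 < eps ->
  exists2 s, posidx s & (sqnormI (fun x => g x - oddcomb phi s x)%R <= eps%:E)%E.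

Variables (phi : R -> C) (b : nat -> C).
Hypothesis phib : sine_expansion phi b.

Lemma measC_oddcomb s : posidx s -> measC (oddcomb phi s).
Proof.
elim: s => [_|e s IH /andP[e0 s0]].
  by rewrite /oddcomb; under eq_fun do rewrite big_nil; apply: measC0.
rewrite /oddcomb; under eq_fun do rewrite big_cons.
by apply: measCD; [apply: measCZ; apply: (phib e0).1 | apply: IH].
Qed.

Lemma approximable_lin c f g : measC f -> measC g ->
  approximable phi f -> approximable phi g -> approximable phi (fun x => c * f x + g x).
Proof.
move=> mf mg af ag eps e0; have e4 : 0 < eps / 4 by rewrite divr_gt0.
have c1 : 0 < normc c ^+ 2 + 1 by rewrite ltr_wpDl // sqr_ge0.
have [s s0 hs] := af _ (divr_gt0 e4 c1); have [t t0 ht] := ag _ e4.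
exists (scal_comb c s ++ t); first by rewrite pos_cat pos_scal s0.
rewrite (@eq_nrm2 _ _ (fun x => c * (f x - oddcomb phi s x) + (g x - oddcomb phi t x))); last first.
  move=> x _; rewrite /oddcomb big_cat big_map /=.
  rewrite (_ : \sum_(j <- s) c * j.2 * odd_ext phi (j.1%:R * x) = c * oddcomb phi s x).
    rewrite /oddcomb; ring.
  by rewrite /oddcomb mulr_sumr; apply: eq_bigr => e _; rewrite mulrA.
apply: nrm2D_le => //.
- by apply: measCZ; apply: measCB => //; apply: measC_oddcomb.
- by apply: measCB => //; apply: measC_oddcomb.
- by apply: nrm2Z_le; [exact: ltW | apply: measCB => //; apply: measC_oddcomb | ].
Qed.

Lemma measC_sin (w : R) : measC (fun x => ((sin (w * x))%:C)%C).
Proof. by apply: measC_real; apply: measurable_sin. Qed.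

(* The n-th sine coefficient of [sin (pi l x) - \sum_e e.2 phi (l e.1 x)] at
   frequency l n is that of [kronecker - dilcomb s b] at n. *)
Lemma approximable_sin l : (0 < l)%N -> l2span b (@kronecker R) ->
  approximable phi (fun x => ((sin (pi * l%:R * x))%:C)%C).
Proof.
move=> l0 clb eps e0; have e4 : 0 < eps / 4 by rewrite divr_gt0.
have [s s0 hs] := clb _ e4; exists (dil_comb l s); first exact: pos_dil.
(* The cut-off [N %/ e.1] is the one produced by [sinpart_dil]; it still tends to infinity with N,
   so u vanishes in the limit. *)
pose u (e : nat * C) N x := odd_ext phi ((l * e.1)%:R * x) - sinpart b (N %/ e.1) ((l * e.1)%:R * x).
have vu e : e \in s -> vanish (u e).
  move=> es; have e10 : (0 < e.1)%N by apply: (allP s0).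
  have le0 : (0 < l * e.1)%N by rewrite muln_gt0 l0.
  have [_ [mv hv]] := phib le0; split=> [N|eta eta0]; first exact: (mv (N %/ e.1)%N).
  have [N0 hN0] := hv _ eta0; exists (N0 * e.1)%N => N hN.
  by apply: (hN0 (N %/ e.1)%N); rewrite leq_divRL.
have [mU hU] := vanish_sum (fun e : nat * C => - e.2) vu.
(* The successor ensures N >= 1, so that the truncation retains the term of [kronecker]. *)
have [N0 hN0] := hU _ e4; pose N := N0.+1.
rewrite (@eq_nrm2 _ _ (fun x => sinpart (fun n => kronecker R n - dilcomb s b n) N (l%:R * x) +
   \sum_(e <- s) - e.2 * u e N x)); last first.
  move=> x _; rewrite /oddcomb big_map /=.
  have -> : sinpart (fun n => kronecker R n - dilcomb s b n) N (l%:R * x) =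
      ((sin (pi * l%:R * x))%:C)%C - \sum_(e <- s) e.2 * sinpart b (N %/ e.1) ((l * e.1)%:R * x).
    transitivity (sinpart (@kronecker R) N (l%:R * x) - sinpart (dilcomb s b) N (l%:R * x)).
      by rewrite /sinpart -sumrB; apply: eq_bigr => n _; rewrite mulrBl.
    congr (_ - _).
      rewrite /sinpart big_ltn // big_nat big1 ?addr0 => [|n /andP[n2 _]].
        by rewrite /kronecker eqxx mul1r mulr1 mulrA.
      by rewrite /kronecker gtn_eqF // mul0r.
    rewrite /dilcomb sinpart_sum big_seq [RHS]big_seq; apply: eq_bigr => e es.
    rewrite sinpart_dil; last by apply: (allP s0).
    by rewrite natrM mulrA (mulrC l%:R).
  rewrite -addrA; congr (_ + _); rewrite -!sumrN -big_split.
  by apply: eq_bigr => e _; rewrite /u /=; ring.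
apply: nrm2D_le; [exact: measC_sinpart | exact: mU | | by apply: hN0].
by apply: le_trans (sinpart_bound _ _ l0) _; rewrite lee_fin; apply: hs.
Qed.

(** Collects repeated indices to reach the form of sum required by [cyclic_class]. *)
Lemma oddcomb_sum s : exists N (a : nat -> C), forall x, posidx s ->
  oddcomb phi s x = \sum_(1 <= k < N.+1) a k * odd_ext phi (k%:R * x).
Proof.
exists (\max_(e <- s) e.1)%N, (fun k => \sum_(e <- s | e.1 == k) e.2) => x s0.
rewrite [RHS](eq_bigr (fun k => \sum_(e <- s | e.1 == k) e.2 * odd_ext phi (k%:R * x))); last first.
  by move=> k _; rewrite mulr_suml.
rewrite (exchange_big_dep xpredT) //=.
rewrite /oddcomb big_seq [RHS]big_seq; apply: eq_bigr => e es.
have ein : e.1 \in index_iota 1 (\max_(e <- s) e.1).+1.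
  by rewrite mem_index_iota (allP s0 _ es) ltnS; apply: (@leq_bigmax_seq _ s xpredT (fun e => e.1)).
rewrite (big_rem _ ein) /= eqxx big1_seq ?addr0 // => k /andP[/eqP ek kr].
by move: kr; rewrite -ek mem_rem_uniqF ?iota_uniq.
Qed.

Lemma sine_expansion_L2 : L2 phi.
Proof.
have [m1 [_ /(_ 1 ltr01)[N /(_ N (leqnn N)) hN]]] := phib (ltn0Sn 0).
have mphi : measC phi.
  have [r1 r2] := m1; split.
    apply: eq_measurable_fun r1 => x; rewrite inE => Ix; by rewrite mul1r odd_ext_I01.
  apply: eq_measurable_fun r2 => x; rewrite inE => Ix; by rewrite mul1r odd_ext_I01.
have [r1 r2] := mphi; split => //; rewrite -/(sqnormI phi).
rewrite (@eq_nrm2 _ _ (fun x => (odd_ext phi (1%:R * x) - sinpart b N (1%:R * x)) + sinpart b N (1%:R * x))).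
  apply: le_lt_trans (nrm2D _ _) _; [by apply: measCB => //; apply: measC_sinpart | exact: measC_sinpart | ].
  apply: lte_add_pinfty; apply: lte_mul_pinfty => //.
    exact: le_lt_trans hN (ltry _).
  exact: le_lt_trans (sinpart_bound _ _ (ltn0Sn 0)) (ltry _).
by move=> x Ix; rewrite subrK mul1r odd_ext_I01.
Qed.

Lemma cyclic_of_l2span : l2span b (@kronecker R) -> cyclic_class phi.
Proof.
move=> clb; split; first exact: sine_expansion_L2.
(* Halving eps turns the non-strict estimates into the strict one required. *)
move=> f Lf eps e0; have e2 : 0 < eps / 2 by rewrite divr_gt0.
have e8 : 0 < eps / 2 / 4 by rewrite divr_gt0.
have [N [d hd]] := sine_complete Lf e8.
have ad M : measC (sinpart d M) /\ approximable phi (sinpart d M).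
  have ms K : measC (sinpart d K).
    have := @measC_sinpart R d K 1; congr measC; apply/funext => x; by rewrite mul1r.
  split=> //; elim: M => [|M IH].
    move=> e ee0; exists [::] => //; rewrite (@eq_nrm2 _ _ (fun=> 0)); last first.
      by move=> x _; rewrite /sinpart /oddcomb !big_nil subrr.
    rewrite /sqnormI; under eq_integral do rewrite ComplexField.Normc.normc0 expr0n /=.
    by rewrite integral0 lee_fin ltW.
  have := approximable_lin (d M.+1) (measC_sin (pi * M.+1%:R)) (ms M) (approximable_sin (ltn0Sn M) clb) IH.
  congr approximable; apply/funext => x; rewrite /sinpart [RHS]big_nat_recr //=.
  by rewrite addrC.
have [md /(_ _ e8)[s s0 hs]] := ad N.
have [K [a aE]] := oddcomb_sum s; exists K, a.
apply: (@le_lt_trans _ _ (eps / 2)%:E); last by rewrite lte_fin; lra.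
rewrite -[X in (X <= _)%E]/(sqnormI (fun x => f x - \sum_(1 <= k < K.+1) a k * odd_ext phi (k%:R * x))).
rewrite (@eq_nrm2 _ _ (fun x => (f x - sinpart d N x) + (sinpart d N x - oddcomb phi s x))); last first.
  by move=> x _; rewrite addrA subrK aE.
apply: nrm2D_le => //.
- by apply: measCB => //; apply: L2_measC.
- by apply: measCB => //; apply: measC_oddcomb.
Qed.

End Cyclicity.

(** * Sine coefficients of S_n *)

Section StepFunctions.
Variable R : realType.
Local Notation C := R[i].
Variables (q : nat) (psi : nat -> C).
Hypothesis q1 : (1 < q)%N.
Hypothesis primP : primitive_char q psi.
Hypothesis psi_even : psi q.-1 = 1.

Lemma eq_sine_expansion (phi : R -> C) (b b' : nat -> C) :
  (forall j, (0 < j)%N -> b j = b' j) -> sine_expansion phi b -> sine_expansion phi b'.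
Proof.
move=> bb h k k0; have [m1 v] := h k k0; split=> //; apply: eq_vanish v => N x.
by congr (_ - _); rewrite /sinpart; apply: eq_big_nat => j /andP[j0 _]; rewrite bb.
Qed.

(** The indicator with left endpoint 2m/(nq) contributes 2 (cos (2 pi jm/(nq)) - cos (pi j)) / (pi
    j). The first cosines add up to the Gauss sum by [half_sum]. *)
Lemma sine_expansion_S_fun n : (0 < n)%N -> sine_expansion (S_fun psi q n) (sine_coef q psi n).
Proof.
move=> n0; set h := ((n * q).-1 %/ 2)%N.
have nq0 : (0 < n * q)%N by rewrite muln_gt0 n0 ltnW.
pose r := [seq m <- index_iota 1 h.+1 | coprime m n].
pose a m : R := (2 * m)%:R / (n * q)%:R.
have a01 m : m \in r -> 0 <= a m < 1.
  rewrite mem_filter mem_index_iota => /andP[_ /andP[m1 mh]].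
  rewrite /a divr_ge0 //= ltr_pdivrMr ?ltr0n // mul1r ltr_nat.
  by move: mh; rewrite /h; lia.
have := @sine_expansion_sum R _ r psi (fun m => step_fun (a m)) _ (fun m mr => sine_expansion_stepf (a01 m mr)).
rewrite (_ : (fun x => \sum_(m <- r) psi m * step_fun (a m) x) = S_fun psi q n); last first.
  by apply/funext => x; rewrite /S_fun /r big_filter.
apply: eq_sine_expansion => j j0.
have hs k : \sum_(m <- r) psi m * ((2 * cos (2 * pi * ((k * m)%:R / (n * q)%:R)))%:C)%C = gauss_sum q psi n k.
  by rewrite /r big_filter; apply: half_sum.
(* [half_sum] at frequency 0: the half sum of psi vanishes, which cancels the cos (pi j) terms. *)
have s0 : \sum_(m <- r) psi m * (2%:C)%C = 0.
  rewrite -[RHS](gsum0 q1 primP n0) -[RHS]hs; apply: eq_bigr => m _.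
  by rewrite mul0n mul0r mulr0 cos0 mulr1.
have s0K : \sum_(m <- r) psi m * (2%:C)%C * ((cos (pi * j%:R) / (pi * j%:R))%:C)%C = 0.
  by rewrite -mulr_suml s0 mul0r.
rewrite /sine_coef -hs mulr_suml -[RHS]subr0 -[X in _ = _ - X]s0K -sumrB; apply: eq_bigr => m _.
rewrite -!mulrA -mulrBr; congr (_ * _).
rewrite -fmorphV -!rmorphM -rmorphB; congr (_%:C)%C.
have j0' : j%:R != 0 :> R by rewrite pnatr_eq0 -lt0n.
have nq0' : (n * q)%:R != 0 :> R by rewrite pnatr_eq0 -lt0n.
have -> : pi * (j%:R * a m) = 2 * (pi * ((j * m)%:R / (n * q)%:R)).
  by rewrite /a !natrM; ring.
have := pi_neq0 R; move: (cos _) => A; move: (cos _) => B; move: (pi : R) => P P0.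
by field; rewrite j0' P0.
Qed.

End StepFunctions.

Theorem theorem1p5 (R : realType) (q : nat) (psi : nat -> R[i]) :
  (1 < q)%N -> primitive_char q psi -> psi q.-1 = 1 ->
  (forall v : nat,
     (exists s : seq nat, [/\ uniq s, all prime s & v = \prod_(p <- s) p]%N) ->
     coprime v q -> cyclic_class (S_fun psi q v)) /\
  (forall (u : nat) (c : nat -> R[i]),
     (0 < u)%N -> ~~ odd u ->
     ((ndiv (u * coprime_part u q))%:R - 1) *
        \big[Num.max/0]_(d <- divisors u | (1 < d)%N) ComplexField.Normc.normc (c d) < ComplexField.Normc.normc (c 1%N) ->
     cyclic_class (fun x => \sum_(d <- divisors u) c d * S_fun psi q d x)).
Proof.
move=> q1 primP even; split=> [v [s [us ps vE]] vq|u c u0 _ hc].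
  have v0 : (0 < v)%N.
    rewrite vE big_seq; apply: prodn_cond_gt0 => p pin.
    by apply: prime_gt0; apply: (allP ps).
  apply: (cyclic_of_l2span (sine_expansion_S_fun q1 primP even v0)).
  by rewrite vE; apply: l2span_coef_squarefree => //; rewrite -vE.
apply: (cyclic_of_l2span _ (l2span_coef_sum q1 primP u0 hc)).
apply: sine_expansion_sum => d; rewrite -dvdn_divisors // => du.
by apply: (sine_expansion_S_fun q1 primP even); apply: dvdn_gt0 du.
Qed.
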